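(* For all $\tau\in\mathbb{C}$ with $\mathrm{Im}(\tau)>0$, as meromorphic functions of $u\in\mathbb{C}$, with $w=\exp(2\pi\sqrt{-1}\,u)$ and $q=\exp(2\pi\sqrt{-1}\,\tau)$, $$\wp(u,\tau)\ =\ (2\pi\sqrt{-1})^2\,\mathcal{W}(w,q)\ -\ \frac{\pi^2}{3}E_2(\tau).$$
   Context: $\wp(u,\tau)$ is the Weierstrass $\wp$-function of the lattice $\mathbb{Z}+\mathbb{Z}\tau$. $\mathcal{W}(w,q)=\sum_{m\in\mathbb{Z}}\frac{wq^m}{(1-wq^m)^2}$, a meromorphic function on $\{(w,q): w\in\mathbb{C}\setminus\{0\},\ 0<|q|<1\}$. $E_2(\tau)=\frac{3}{\pi^2}\sum_{m\in\mathbb{Z}}\Big(\sum_{n\in\mathbb{Z}}{}^{'}\frac{1}{(m\tau+n)^2}\Big)$ is the Eisenstein series of weight 2, where the inner sum over $n$ is carried out first and $'$ means that $n=0$ is omitted if $m=0$. *)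

(* Defs.v *)
From mathcomp Require Import all_boot all_order all_algebra.
From mathcomp Require Import complex.
From mathcomp Require Import all_classical all_reals all_analysis.
From mathcomp Require Import summability.

Set Implicit Arguments.
Unset Strict Implicit.
Unset Printing Implicit Defensive.

Import Order.TTheory GRing.Theory Num.Theory.
Import numFieldNormedType.Exports.

Local Open Scope classical_set_scope.
Local Open Scope ring_scope.
Local Open Scope complex_scope.

(* Sums over an infinite index set are unordered: [csum x] is the limit of the
   finite partial sums of [x] along the directed set of finite subsets.  The
   regular module [R[i]^o] carries the topology of the complex modulus. *)
Definition csum (R : realType) (I : choiceType) (x : I -> R[i]) : R[i] :=
  summability.sum (x : I -> R[i]^o).

Definition cexp (R : realType) (z : R[i]) : R[i] :=
  (expR (complex.Re z))%:C *
  ((cos (complex.Im z))%:C + 'i%C * (sin (complex.Im z))%:C).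

Definition lattice_point (R : realType) (tau : R[i]) (p : int * int) : R[i] :=
  p.1%:~R * tau + p.2%:~R.

Definition lattice (R : realType) (tau : R[i]) : set R[i] :=
  range (lattice_point tau).

Definition wp (R : realType) (u tau : R[i]) : R[i] :=
  1 / u ^+ 2 +
  csum (fun p : int * int =>
    if p == (0, 0) then 0
    else 1 / (u - lattice_point tau p) ^+ 2 - 1 / lattice_point tau p ^+ 2).

Definition calW (R : realType) (w q : R[i]) : R[i] :=
  csum (fun m : int => w * q ^ m / (1 - w * q ^ m) ^+ 2).

Definition E2 (R : realType) (tau : R[i]) : R[i] :=
  3 / (pi : R)%:C ^+ 2 *
  csum (fun m : int => csum (fun n : int =>
    if (m == 0) && (n == 0) then 0 else 1 / (m%:~R * tau + n%:~R) ^+ 2)).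

(* Complex differentiability at [z], i.e. derivability over the field [R[i]]. *)
Definition cderivable (R : realType) (f : R[i] -> R[i]) (z : R[i]) : Prop :=
  derivable (f : R[i]^o -> R[i]^o) z 1.

(* Meromorphic functions on the plane: near every [z0], away from [z0] itself,
   [f] is [g z / (z - z0) ^ k] with [g] holomorphic on a neighbourhood of [z0].
   The value of [f] at a pole is irrelevant. *)
Definition meromorphic (R : realType) (f : R[i] -> R[i]) : Prop :=
  forall z0 : R[i]^o, exists (k : nat) (g : R[i] -> R[i]),
    (\forall z \near z0, cderivable g z) /\
    (\forall z \near z0^', f z = g z / (z - z0) ^+ k).

(* Main.v *)
Require Import Defs.
From mathcomp Require Import all_boot all_order all_algebra.
From mathcomp Require Import complex finmap ring lra zify.
From mathcomp Require Import all_classical all_reals all_analysis.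
From mathcomp Require Import summability.

Import Order.TTheory GRing.Theory Num.Theory.
Import numFieldNormedType.Exports.

Local Open Scope classical_set_scope.
Local Open Scope ring_scope.
Local Open Scope complex_scope.

Set Implicit Arguments.
Unset Strict Implicit.
Unset Printing Implicit Defensive.

(** The Weierstrass series is absolutely convergent after the subtraction of
    1 / lambda^2, so it may be summed along the rows of the lattice (Fubini,
    [sums_to_iter]). The row of index m contributes the sum over n of
    1 / (u - m tau - n)^2 minus the corresponding row of the Eisenstein series.
    The first part is given in closed form by the partial fraction expansion

      sum over n of 1 / (z + n)^2 = pi^2 / sin^2 (pi z)
                                  = (2 pi i)^2 e / (1 - e)^2,  e = exp (2 pi i z),

    which is [sums_to_cscsq]. At z = u - m tau, where e = w q^(-m), it is
    (2 pi i)^2 times a term of the q-series. The rows of the Eisenstein series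
    are summable by themselves, because |pi^2 / sin^2 (pi z)| <= 1 / (Im z)^2
    ([cscsq_le_Im]); hence the sum over m splits into the two terms of the
    identity ([wp_q_expansion]).

    The partial fraction expansion is proved without complex integration. The
    function c(z) = pi^2 / sin^2 (pi z) satisfies
    4 c(z) = c(z/2) + c((z+1)/2), so N^2 c(z) is the sum of c((z+n)/N) over any N
    consecutive integers n, for N a power of 2 ([cscsq_multiplication] and
    periodicity). Near 0 the difference c(z) - 1/z^2 is bounded
    ([cscsq_pole_bound]), so replacing every c((z+n)/N) by N^2 / (z+n)^2, for n
    in a window centred at 0, costs at most a constant times N, which becomes
    O(1/N) after division by N^2.

    Meromorphy of the Weierstrass function comes from bounds on its terms, on
    their derivatives and on the quadratic remainders of their first-order
    expansions, uniform near a given point and summable over the lattice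
    ([wp_term_bounds]); the series can then be differentiated term by term
    ([csum_cderivable]). The right-hand side agrees with the Weierstrass function
    off the lattice, which is discrete, and so inherits its meromorphy. *)

(** * The real modulus of a complex number *)

Section Modulus.
Variable R : realType.
Implicit Types z w : R[i].

Definition cmod z : R := Normc.normc z.

Lemma cmodE z : `|z| = (cmod z)%:C. Proof. by []. Qed.

Lemma cmod_ge0 z : 0 <= cmod z.
Proof. by case: z => a b; apply: sqrtr_ge0. Qed.

Lemma cmodM z w : cmod (z * w) = cmod z * cmod w.
Proof. exact: Normc.normcM. Qed.

Lemma cmodV z : cmod z^-1 = (cmod z)^-1.
Proof. exact: Normc.normcV. Qed.

Lemma cmodD z w : cmod (z + w) <= cmod z + cmod w.
Proof. exact: le_normcD. Qed.

Lemma cmodN z : cmod (- z) = cmod z.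
Proof. exact: normcN. Qed.

Lemma cmodB z w : cmod (z - w) <= cmod z + cmod w.
Proof. by rewrite -(cmodN w) cmodD. Qed.

Lemma cmodC z w : cmod (z - w) = cmod (w - z).
Proof. by rewrite -cmodN opprB. Qed.

Lemma cmod0 : cmod 0 = 0.
Proof. exact: Normc.normc0. Qed.

Lemma cmod1 : cmod 1 = 1.
Proof. exact: Normc.normc1. Qed.

Lemma cmod_eq0 z : (cmod z == 0) = (z == 0).
Proof.
by apply/eqP/eqP => [/Normc.eq0_normc //|->]; rewrite cmod0.
Qed.

Lemma cmod_gt0 z : (0 < cmod z) = (z != 0).
Proof. by rewrite lt_def cmod_ge0 andbT cmod_eq0. Qed.

Lemma cmodX z n : cmod (z ^+ n) = cmod z ^+ n.
Proof. by elim: n => [|n IH]; rewrite ?expr0 ?cmod1 // !exprS cmodM IH. Qed.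

Lemma cmod_sqr z : cmod z ^+ 2 = complex.Re z ^+ 2 + complex.Im z ^+ 2.
Proof. by case: z => a b; rewrite sqr_sqrtr // addr_ge0 ?sqr_ge0. Qed.

Lemma cmod_real (x : R) : cmod x%:C = `|x|.
Proof. by rewrite /cmod /= expr0n addr0 sqrtr_sqr. Qed.

Lemma cmod_i : cmod 'i%C = 1.
Proof. by rewrite /cmod /= expr0n expr1n add0r sqrtr1. Qed.

Lemma cmod_Re z : `|complex.Re z| <= cmod z.
Proof.
case: z => a b /=; rewrite /cmod /= -sqrtr_sqr ler_wsqrtr //.
by rewrite lerDl sqr_ge0.
Qed.

Lemma cmod_Im z : `|complex.Im z| <= cmod z.
Proof.
case: z => a b /=; rewrite /cmod /= -sqrtr_sqr ler_wsqrtr //.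
by rewrite lerDr sqr_ge0.
Qed.

Lemma cmod_int (n : int) : cmod n%:~R = `|n|%:~R.
Proof. by rewrite -(rmorph_int (real_complex R)) cmod_real intr_norm. Qed.

Lemma cmod_nat (n : nat) : cmod n%:R = n%:R.
Proof. by rewrite -(rmorph_nat (real_complex R)) cmod_real normr_nat. Qed.

Lemma cmod_sum (I : Type) (s : seq I) (x : I -> R[i]) :
  cmod (\sum_(i <- s) x i) <= \sum_(i <- s) cmod (x i).
Proof.
elim: s => [|i s IH]; rewrite ?big_nil ?cmod0 // !big_cons.
by apply: le_trans (cmodD _ _) _; rewrite lerD2l.
Qed.

Lemma cmod_le_triangle z w : cmod z <= cmod (z - w) + cmod w.
Proof. by rewrite -[X in cmod X <= _](subrK w) cmodD. Qed.

End Modulus.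
Arguments cmod : simpl never.

(** * Unordered sums *)

Section UnorderedSums.
Variable R : realType.

(** Convergence along finite subsets, phrased with duplicate-free sequences:
    these can be mapped, concatenated and multiplied freely, and [sums_to_csum]
    is the only bridge to the limit along finite sets. *)
Definition sums_to (I : eqType) (x : I -> R[i]) (s : R[i]) : Prop :=
  forall e : R, 0 < e -> exists s0 : seq I, forall t : seq I,
    uniq t -> {subset s0 <= t} -> cmod (\sum_(i <- t) x i - s) <= e.

Definition abs_bounded (I : eqType) (x : I -> R[i]) (M : R) : Prop :=
  forall t : seq I, uniq t -> \sum_(i <- t) cmod (x i) <= M.

Lemma sums_to_csum (I : choiceType) (x : I -> R[i]) s :
  sums_to x s -> csum x = s.
Proof.
move=> xs; have pF := @totally_filter I.
apply: (@cvg_lim (R[i]^o)); first exact: norm_hausdorff.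
apply/cvgrPdist_le => e e0.
have [e' e'E] : exists e' : R, e = e'%:C.
  by exists (complex.Re e); rewrite RRe_real // gtr0_real.
move: e0; rewrite e'E ltcR => e0.
have [s0 Hs0] := xs _ e0.
exists [fset i in s0]%fset => // A /= s0A.
rewrite cmodE lecR cmodC /partial_sum -(big_seq_fsetE _ A xpredT x) /=.
apply: Hs0 => [|i is0]; first exact: fset_uniq.
by apply: (fsubsetP s0A); rewrite inE.
Qed.

Lemma eq_sums_to (I : eqType) (x y : I -> R[i]) s :
  x =1 y -> sums_to x s -> sums_to y s.
Proof.
move=> xy xs e e0; have [s0 H] := xs e e0; exists s0 => t ut st.
by rewrite -(eq_bigr _ (fun i _ => xy i)); apply: H.
Qed.

Lemma sums_toD (I : eqType) (x y : I -> R[i]) s s' :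
  sums_to x s -> sums_to y s' -> sums_to (fun i => x i + y i) (s + s').
Proof.
move=> xs ys e e0.
have e20 : 0 < e / 2 by rewrite divr_gt0.
have [s0 H] := xs _ e20; have [s1 H'] := ys _ e20.
exists (s0 ++ s1) => t ut st.
have h1 := H t ut (fun i h => st i (etrans (mem_cat i s0 s1) (introT orP (or_introl h)))).
have h2 := H' t ut (fun i h => st i (etrans (mem_cat i s0 s1) (introT orP (or_intror h)))).
rewrite big_split /= opprD addrACA.
by apply: le_trans (cmodD _ _) _; lra.
Qed.

Lemma sums_toZ (I : eqType) (a : R[i]) (x : I -> R[i]) s :
  sums_to x s -> sums_to (fun i => a * x i) (a * s).
Proof.
move=> xs e e0.
have c0 : 0 < cmod a + 1 by rewrite ltr_wpDl ?cmod_ge0.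
have [s0 H] := xs (e / (cmod a + 1)) (divr_gt0 e0 c0).
exists s0 => t ut st; rewrite -mulr_sumr -mulrBr cmodM.
have := H t ut st; rewrite ler_pdivlMr // mulrC; apply: le_trans.
by rewrite ler_wpM2r ?cmod_ge0 // lerDl.
Qed.

Lemma sums_toB (I : eqType) (x y : I -> R[i]) s s' :
  sums_to x s -> sums_to y s' -> sums_to (fun i => x i - y i) (s - s').
Proof.
move=> xs /(sums_toZ (-1)) ys; have := sums_toD xs ys.
by rewrite mulN1r; apply: eq_sums_to => i; rewrite mulN1r.
Qed.

Lemma sums_to_single (I : eqType) (i0 : I) (a : R[i]) :
  sums_to (fun i => if i == i0 then a else 0) a.
Proof.
move=> e e0; exists [:: i0] => t ut st.
rewrite (bigD1_seq i0) ?st ?mem_head //= eqxx big1 => [|i /negbTE -> //].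
by rewrite addr0 subrr cmod0 ltW.
Qed.

Lemma sums_to_reindex (I J : eqType) (f : I -> J) (x : J -> R[i]) s :
  bijective f -> sums_to x s -> sums_to (fun i => x (f i)) s.
Proof.
move=> [g fK gK] xs e e0; have [s0 H] := xs e e0.
exists (map g s0) => t ut st; rewrite -(big_map f xpredT x).
apply: H => [|j js]; first by rewrite map_inj_uniq //; apply: can_inj fK.
by rewrite -[j]gK map_f // st // map_f.
Qed.

Lemma sums_to_big (A I : eqType) (r : seq A) (x : A -> I -> R[i])
    (y : A -> R[i]) :
  (forall a, sums_to (x a) (y a)) ->
  sums_to (fun i => \sum_(a <- r) x a i) (\sum_(a <- r) y a).
Proof.
move=> xy; elim: r => [|a r IH].
  rewrite big_nil => e e0; exists [::] => t _ _.
  rewrite big1 ?subr0 ?cmod0 ?ltW // => i _; exact: big_nil.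
rewrite big_cons; apply: eq_sums_to (sums_toD (xy a) IH) => i.
by rewrite big_cons.
Qed.

(** Fubini for unordered sums. A rectangle A x B with B large enough has a sum
    close to the sum over A of the row sums, and it can be enlarged in the second
    coordinate until it contains any prescribed finite set of indices. *)
Lemma sums_to_iter (I J : eqType) (x : I * J -> R[i]) (y : I -> R[i]) s :
  sums_to x s -> (forall i, sums_to (fun j => x (i, j)) (y i)) ->
  sums_to y s.
Proof.
move=> xs xy e e0.
have e20 : 0 < e / 2 by rewrite divr_gt0.
have [s0 H] := xs _ e20; exists (map fst s0) => t ut st.
have [s1 H'] := sums_to_big t xy e20.
(* B serves both purposes: it contains s1, and t x B contains s0. *)
pose B := undup (s1 ++ map snd s0).
have uB : uniq B by rewrite undup_uniq.
have h1 : {subset s1 <= B} by move=> j h; rewrite mem_undup mem_cat h.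
have := H' B uB h1; rewrite exchange_big /= -(big_allpairs_dep (h := pair) (F := x)) => h2.
have h3 : uniq [seq (i, j) | i <- t, j <- B].
  by apply: allpairs_uniq => // -[a b] [c d].
have h4 : {subset s0 <= [seq (i, j) | i <- t, j <- B]}.
  move=> [i j] ij; apply/allpairsP; exists (i, j); split => //=.
    by apply: st; apply/mapP; exists (i, j).
  by rewrite mem_undup mem_cat; apply/orP; right; apply/mapP; exists (i, j).
have := H _ h3 h4; move: h2; set S := \sum_(_ <- _) _; set Y := \sum_(_ <- _) _.
move=> h2 h5; have -> : Y - s = (S - s) - (S - Y) by ring.
have := cmodB (S - s) (S - Y); lra.
Qed.

Lemma ler_sum_subset (I : eqType) (s t : seq I) (f : I -> R) :
  (forall i, 0 <= f i) -> uniq s -> uniq t -> {subset s <= t} ->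
  \sum_(i <- s) f i <= \sum_(i <- t) f i.
Proof.
move=> f0 us ut st.
have pt : perm_eq t (s ++ [seq i <- t | i \notin s]).
  apply: uniq_perm => //.
    rewrite cat_uniq us filter_uniq // andbT; apply/hasPn => i.
    by rewrite mem_filter => /andP[].
  by move=> i; rewrite mem_cat mem_filter; case: (boolP (i \in s)) => //= /st ->.
by rewrite (perm_big _ pt) big_cat /= lerDl sumr_ge0.
Qed.

(** The sum is the supremum of the finite partial sums. *)
Lemma sums_to_nneg (I : eqType) (y : I -> R) M :
  (forall i, 0 <= y i) -> abs_bounded (fun i => (y i)%:C) M ->
  exists s, sums_to (fun i => (y i)%:C) s.
Proof.
move=> y0 yM.
have yM' t : uniq t -> \sum_(i <- t) y i <= M.
  move=> /yM; congr (_ <= _); apply: eq_bigr => i _.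
  by rewrite cmod_real ger0_norm.
pose E := [set r : R | exists2 t : seq I, uniq t & r = \sum_(i <- t) y i].
have Esup : has_sup E.
  split; first by exists 0; exists [::]; rewrite ?big_nil.
  by exists M => r [t /yM' h ->].
exists (sup E)%:C => e e0.
have [r [s0 us0 ->] s0E] := sup_adherent e0 Esup.
exists s0 => t ut st.
rewrite -rmorph_sum -rmorphB cmod_real ler_norml; apply/andP; split.
  suff : \sum_(i <- s0) y i <= \sum_(i <- t) y i by lra.
  exact: ler_sum_subset.
suff : \sum_(i <- t) y i <= sup E by lra.
by apply: sup_upper_bound => //; exists t.
Qed.

Lemma abs_bounded_le (I : eqType) (x y : I -> R[i]) M C :
  0 <= C -> (forall i, cmod (x i) <= C * cmod (y i)) ->
  abs_bounded y M -> abs_bounded x (C * M).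
Proof.
move=> C0 xy yM t ut; apply: (@le_trans _ _ (\sum_(i <- t) C * cmod (y i))).
  by apply: ler_sum.
by rewrite -mulr_sumr ler_wpM2l // yM.
Qed.

(** Absolute summability gives convergence: x is a combination of the three
    families Re x + |x|, Im x + |x| and |x|, whose terms are nonnegative reals. *)
Lemma abs_bounded_sums_to (I : eqType) (x : I -> R[i]) M :
  abs_bounded x M -> exists s, sums_to x s.
Proof.
move=> xM.
have aux (y : I -> R) : (forall i, `|y i| <= cmod (x i)) ->
    exists s, sums_to (fun i => (y i + cmod (x i))%:C) s.
  move=> yx; apply: (@sums_to_nneg _ _ (2 * M)) => [i|].
    by have := yx i; rewrite ler_norml => /andP[h _]; lra.
  apply: abs_bounded_le xM => // i; rewrite cmod_real.
  by have := ler_normD (y i) (cmod (x i)); have := yx i; rewrite (ger0_norm (cmod_ge0 _)); lra.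
have [s1 h1] := aux _ (fun i => cmod_Re (x i)).
have [s2 h2] := aux _ (fun i => cmod_Im (x i)).
have [s3 h3] := aux (fun=> 0) (fun i => eq_ind_r (fun y => y <= _) (cmod_ge0 _) (normr0 _)).
exists (s1 + 'i%C * s2 - (1 + 'i%C) * s3).
apply: eq_sums_to (sums_toB (sums_toD h1 (sums_toZ 'i%C h2)) (sums_toZ (1 + 'i%C) h3)) => i.
rewrite add0r 2!rmorphD /= [RHS]complexE; ring.
Qed.

Lemma sums_to_le (I : eqType) (x : I -> R[i]) M s :
  abs_bounded x M -> sums_to x s -> cmod s <= M.
Proof.
move=> xM xs; apply/ler_addgt0Pl => e e0; have [s0 H] := xs e e0.
have := H (undup s0) (undup_uniq _).
move=> /(_ (fun i => etrans (mem_undup s0 i))) h.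
have := cmod_le_triangle s (\sum_(i <- undup s0) x i); rewrite cmodC.
have := cmod_sum (undup s0) x; have := xM _ (undup_uniq s0); lra.
Qed.

End UnorderedSums.

(** * Taylor bounds for sin, cos, sinh and cosh *)

Section RealFacts.
Variable R : realType.
Implicit Types x y : R.

Definition cosh x : R := (expR x + expR (- x)) / 2.
Definition sinh x : R := (expR x - expR (- x)) / 2.

(** The mean value theorem between 0 and y, whatever the sign of y. It produces
    the Taylor bounds below one order at a time. *)
Lemma mean_value0 (f df : R -> R) y :
  (forall x, is_derive x 1 f (df x)) -> f 0 = 0 ->
  exists2 c, `|c| <= `|y| & f y = df c * y.
Proof.
move=> fdf f0.
have fc a b : {within `[a, b], continuous f}.
  apply: derivable_within_continuous => x _; exact: (@ex_derive _ _ _ _ _ _ _ (fdf x)).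
case: (leP 0 y) => y0.
  have [c] := MVT_segment y0 (fun x _ => fdf x) (fc _ _).
  rewrite in_itv /= f0 !subr0 => /andP[c0 cy] ->; exists c => //.
  by rewrite !ger0_norm.
have [c] := MVT_segment (ltW y0) (fun x _ => fdf x) (fc _ _).
rewrite in_itv /= f0 => /andP[yc c0] h; exists c.
  by rewrite !ler0_norm ?lerN2 // ltW.
by move: h; lra.
Qed.

Lemma is_derive_expRN x : is_derive x 1 (fun t : R => expR (- t)) (- expR (- x)).
Proof.
have h := @is_derive1_comp R expR -%R x _ _ (is_derive_expR (- x)) (is_deriveNid x 1).
by rewrite mulrN1 in h.
Qed.

Lemma is_derive_sinh x : is_derive x 1 sinh (cosh x).
Proof.
have h := is_deriveZ (2^-1) (is_deriveB (is_derive_expR x) (is_derive_expRN x)).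
have -> : sinh = 2^-1 \*: (expR - (fun t : R => expR (- t))).
  by apply/funext => t; rewrite /sinh mulrC.
by have -> : cosh x = 2^-1 *: (expR x - - expR (- x)); rewrite // opprK /cosh mulrC.
Qed.

Lemma cosh_ge1 x : 1 <= cosh x.
Proof. by rewrite /cosh; have := expR_ge1Dx x; have := expR_ge1Dx (- x); lra. Qed.

Lemma cosh_le x : `|x| <= 4 -> cosh x <= expR 4.
Proof.
rewrite ler_norml /cosh => /andP[h1 h2].
have : expR x <= expR 4 by rewrite ler_expR.
have : expR (- x) <= expR 4 by rewrite ler_expR; lra.
lra.
Qed.

Lemma sinh0 : sinh 0 = 0.
Proof. by rewrite /sinh oppr0 subrr mul0r. Qed.

Lemma le_norm_sinh x : `|x| <= `|sinh x|.
Proof.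
have [c _ ->] := mean_value0 x is_derive_sinh sinh0.
by rewrite normrM ler_peMl // (le_trans _ (ler_norm _)) // cosh_ge1.
Qed.

Lemma norm_sinh_le x : `|x| <= 4 -> `|sinh x| <= expR 4 * `|x|.
Proof.
move=> x4; have [c cx ->] := mean_value0 x is_derive_sinh sinh0.
rewrite normrM ler_wpM2r // ger0_norm ?cosh_le ?(le_trans cx) //.
by rewrite (le_trans _ (cosh_ge1 _)).
Qed.

Lemma cosh_double x : cosh x - 1 = 2 * sinh (x / 2) ^+ 2.
Proof.
have -> : cosh x = (expR (x / 2) * expR (x / 2) + expR (- (x / 2)) * expR (- (x / 2))) / 2.
  by rewrite /cosh -!expRD; congr ((expR _ + expR _) / 2); lra.
rewrite /sinh.
have := expRxMexpNx_1 (x / 2); set a := expR (x / 2); set b := expR (- (x / 2)).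
move=> ab; have -> : 2 * ((a - b) / 2) ^+ 2 = (a * a + b * b) / 2 - a * b by field.
by rewrite ab.
Qed.

Lemma cosh_sub1_le x : `|x| <= 4 -> `|cosh x - 1| <= expR 4 ^+ 2 * x ^+ 2 / 2.
Proof.
move=> x4; rewrite cosh_double ger0_norm; last by apply: mulr_ge0; rewrite ?sqr_ge0.
have h2 : `|x / 2| = `|x| / 2 by rewrite normrM normfV normr_nat.
have := @norm_sinh_le (x / 2); rewrite h2.
have x40 : `|x| / 2 <= 4 by have := normr_ge0 x; lra.
move=> /(_ x40) h; rewrite -(real_normK (num_real (sinh (x / 2)))) -(real_normK (num_real x)).
have : `|sinh (x / 2)| ^+ 2 <= (expR 4 * (`|x| / 2)) ^+ 2 by rewrite lerXn2r ?nnegrE ?mulr_ge0 ?expR_ge0.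
rewrite exprMn; lra.
Qed.

Lemma sinh_sub_le y : `|y| <= 4 -> `|sinh y - y| <= expR 4 ^+ 2 * `|y| ^+ 3 / 2.
Proof.
move=> y4.
have f0 : sinh 0 - 0 = 0 :> R by rewrite sinh0 subr0.
have fd x : is_derive x 1 (fun t => sinh t - t) (cosh x - 1).
  exact: is_deriveB (is_derive_sinh x) (is_derive_id x 1).
have [c cy /= ->] := mean_value0 y fd f0; rewrite normrM.
have := cosh_sub1_le (le_trans cy y4) => h.
have h2 : c ^+ 2 <= `|y| ^+ 2 by rewrite -(real_normK (num_real c)) lerXn2r ?nnegrE.
rewrite (_ : _ / 2 = expR 4 ^+ 2 * `|y| ^+ 2 / 2 * `|y|); last by field.
rewrite ler_wpM2r //.
apply: le_trans h _; rewrite ler_wpM2r // ler_wpM2l // sqr_ge0.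
Qed.

Lemma norm_sin_le x : `|sin x| <= `|x|.
Proof.
have [c _ ->] := mean_value0 x (@is_derive_sin R) (sin0 R).
by rewrite normrM ler_piMl // ler_norml cos_geN1 cos_le1.
Qed.

Lemma cos_sub1_le x : `|cos x - 1| <= x ^+ 2 / 2.
Proof.
have -> : cos x - 1 = - (2 * sin (x / 2) ^+ 2).
  have xE : x = (x / 2) *+ 2 by rewrite mulr2n; lra.
  by rewrite {1}xE cos_mulr2n cos2sin2; ring.
rewrite normrN ger0_norm; last by apply: mulr_ge0; rewrite ?sqr_ge0.
have : sin (x / 2) ^+ 2 <= (x / 2) ^+ 2.
  rewrite -(real_normK (num_real (sin _))) -(real_normK (num_real (x / 2))).
  by rewrite lerXn2r ?nnegrE // norm_sin_le.
by rewrite exprMn; lra.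
Qed.

Lemma sin_sub_le y : `|sin y - y| <= `|y| ^+ 3 / 2.
Proof.
have f0 : sin 0 - 0 = 0 :> R by rewrite sin0 subr0.
have fd x : is_derive x 1 (fun t => sin t - t) (cos x - 1).
  exact: is_deriveB (is_derive_sin x) (is_derive_id x 1).
have [c cy /= ->] := mean_value0 y fd f0; rewrite normrM.
have := cos_sub1_le c => h.
have h2 : c ^+ 2 <= `|y| ^+ 2 by rewrite -(real_normK (num_real c)) lerXn2r ?nnegrE.
rewrite (_ : _ / 2 = `|y| ^+ 2 / 2 * `|y|); last by field.
rewrite ler_wpM2r //.
by apply: le_trans h _; rewrite ler_wpM2r.
Qed.

(** A slope such that |sin x| >= sin_slope |x| up to 3 pi / 4. It comes from
    sin x = 2 sin (x/2) cos (x/2) >= x cos^2 (x/2) = x (1 + cos x) / 2. The range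
    has to exceed pi / 2 because windows of integers are centred at 0 and not at
    the point where the partial fraction is taken. *)
Definition sin_slope : R := (1 + cos (3 / 4 * pi)) / 2.

Lemma sin_slope_gt0 : 0 < sin_slope.
Proof.
have p0 := pi_gt0 R.
suff : cos pi < cos (3 / 4 * pi) :> R by rewrite cospi /sin_slope; lra.
by rewrite ltr_cos ?in_itv /=; lra.
Qed.

Lemma sin_slope_le1 : sin_slope <= 1.
Proof. by rewrite /sin_slope; have := cos_le1 (3 / 4 * pi : R); lra. Qed.

Lemma sin_ge_slope x : `|x| <= 3 / 4 * pi -> sin_slope * `|x| <= `|sin x|.
Proof.
have p0 := pi_gt0 R.
wlog x0 : x / 0 <= x.
  move=> H; case: (leP 0 x) => [|/ltW x0]; first exact: H.
  by rewrite -normrN -(normrN (sin x)) -sinN; apply: H; rewrite oppr_ge0.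
rewrite ger0_norm // => x3.
apply: le_trans (ler_norm _).
have xE : x = (x / 2) *+ 2 by rewrite mulr2n; lra.
have [c cx sE] := mean_value0 (x / 2) (@is_derive_sin R) (sin0 R).
have cge : cos (x / 2) <= cos c.
  rewrite -(cos_norm c); rewrite (ger0_norm (_ : 0 <= x / 2)) in cx; last lra.
  by rewrite leNgt ltr_cos ?in_itv /= -?leNgt // ?normr_ge0 /=; lra.
have c0 : 0 <= cos (x / 2) by apply: cos_ge0_pihalf; lra.
rewrite {2}xE sin_mulr2n sE.
have : cos (3 / 4 * pi) <= cos x.
  by rewrite leNgt ltr_cos ?in_itv /= -?leNgt //; lra.
rewrite {1}xE cos_mulr2n => h.
have hs : sin_slope <= cos (x / 2) * cos (x / 2).
  by move: h; rewrite /sin_slope expr2 mulr2n; lra.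
rewrite (_ : cos (x / 2) * _ *+ 2 = cos (x / 2) * cos c * x); last first.
  by rewrite mulr2n; field.
by rewrite ler_wpM2r // (le_trans hs) // ler_wpM2l.
Qed.

End RealFacts.

(** * The complex exponential and the complex sine *)

Section ComplexSine.
Variable R : realType.
Implicit Types z w : R[i].

Lemma cexpD z w : cexp (z + w) = cexp z * cexp w.
Proof.
case: z => a b; case: w => c d; rewrite /cexp /= expRD cosD sinD.
by apply/eqP; rewrite eq_complex /=; apply/andP; split; apply/eqP; ring.
Qed.

Lemma cexp0 : cexp 0 = 1 :> R[i].
Proof.
rewrite /cexp /= expR0 cos0 sin0.
by apply/eqP; rewrite eq_complex /=; apply/andP; split; apply/eqP; ring.
Qed.

Lemma cexp_neq0 z : cexp z != 0.
Proof.
apply/eqP => z0; have := cexpD z (- z); rewrite subrr cexp0 z0 mul0r => /eqP.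
by rewrite oner_eq0.
Qed.

Lemma cexpN z : cexp (- z) = (cexp z)^-1.
Proof.
apply: (mulfI (cexp_neq0 z)).
by rewrite -cexpD subrr cexp0 mulfV // cexp_neq0.
Qed.

(** The exponential of period 1, which sends u to w and tau to q. *)
Definition qexp z : R[i] := cexp (2 * (pi : R)%:C * 'i%C * z).

Lemma qexpD z w : qexp (z + w) = qexp z * qexp w.
Proof. by rewrite /qexp mulrDr cexpD. Qed.

Lemma qexp0 : qexp 0 = 1.
Proof. by rewrite /qexp mulr0 cexp0. Qed.

Lemma qexpN z : qexp (- z) = (qexp z)^-1.
Proof. by rewrite /qexp mulrN cexpN. Qed.

Lemma qexp_half : qexp (1 / 2) = -1.
Proof.
have -> : qexp (1 / 2) = cexp (0 +i* pi).
  by rewrite /qexp; congr cexp; rewrite [RHS]complexE /= add0r; field.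
rewrite /cexp /= expR0 cospi sinpi.
by apply/eqP; rewrite eq_complex /=; apply/andP; split; apply/eqP; ring.
Qed.

Lemma qexp1 : qexp 1 = 1.
Proof.
have := qexpD (1 / 2) (1 / 2); rewrite qexp_half mulrNN mulr1.
by have -> : 1 / 2 + 1 / 2 = 1 :> R[i] by field.
Qed.

Lemma qexp_nat z (n : nat) : qexp (n%:R * z) = qexp z ^+ n.
Proof.
elim: n => [|n IH]; first by rewrite mul0r qexp0 expr0.
by rewrite -natr1 mulrDl mul1r qexpD IH exprSr.
Qed.

Lemma qexp_int z (n : int) : qexp (n%:~R * z) = qexp z ^ n.
Proof.
case: n => n; first by rewrite -pmulrn qexp_nat.
by rewrite NegzE mulrNz mulNr qexpN qexp_nat exprnN.
Qed.

Lemma qexpDint z (n : int) : qexp (z + n%:~R) = qexp z.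
Proof. by rewrite qexpD -[n%:~R]mulr1 qexp_int qexp1 exp1rz mulr1. Qed.

Lemma i_neq0 : 'i%C != 0 :> R[i].
Proof. by rewrite eq_complex /= oner_eq0 andbF. Qed.

Definition csin z : R[i] := (cexp ('i%C * z) - cexp (- ('i%C * z))) / (2 * 'i%C).

Lemma csinE (x y : R) :
  csin (x +i* y) = (sin x * cosh y) +i* (cos x * sinh y).
Proof.
rewrite /csin; apply: canLR (mulfK _) _.
  by rewrite mulf_neq0 ?i_neq0 ?pnatr_eq0.
rewrite /cexp /cosh /sinh /= !mul0r !mul1r !add0r opprK cosN sinN.
by apply/eqP; rewrite eq_complex /=; apply/andP; split; apply/eqP; field.
Qed.

(** Both lower bounds for the sine, in terms of the imaginary part alone and in
    terms of the modulus, are read off this formula. *)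
Lemma cmod_csin_sqr (x y : R) :
  cmod (csin (x +i* y)) ^+ 2 = sin x ^+ 2 + sinh y ^+ 2.
Proof.
rewrite csinE cmod_sqr /=.
have h1 := cos2Dsin2 x.
have : cosh y ^+ 2 - sinh y ^+ 2 = 1.
  by rewrite -(expRxMexpNx_1 y) /cosh /sinh; field.
move: h1; rewrite (exprMn _ (sin x)) (exprMn _ (cos x)); set s := sin x ^+ 2; set c := cos x ^+ 2.
set C := cosh y ^+ 2; set S := sinh y ^+ 2 => h1 h2.
have -> : C = 1 + S by lra.
have -> : c = 1 - s by lra.
ring.
Qed.

Lemma cmod_csin_ge_Im z : `|complex.Im z| <= cmod (csin z).
Proof.
case: z => x y /=; apply: le_trans (le_norm_sinh y) _.
rewrite -ler_sqr ?nnegrE ?cmod_ge0 // cmod_csin_sqr real_normK ?num_real //.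
by rewrite lerDr sqr_ge0.
Qed.

Lemma cmod_csin_ge z : `|complex.Re z| <= 3 / 4 * pi ->
  sin_slope R * cmod z <= cmod (csin z).
Proof.
case: z => x y /= x3.
have s0 := sin_slope_gt0 R; have s1 := sin_slope_le1 R.
rewrite -ler_sqr ?nnegrE ?cmod_ge0 //; last by rewrite mulr_ge0 ?cmod_ge0 // ltW.
rewrite cmod_csin_sqr exprMn cmod_sqr /= mulrDr.
apply: lerD.
  rewrite -(real_normK (num_real x)) -exprMn -(real_normK (num_real (sin x))).
  by rewrite ler_sqr ?nnegrE ?sin_ge_slope // mulr_ge0 // ltW.
rewrite -(real_normK (num_real y)) -exprMn -(real_normK (num_real (sinh y))).
rewrite ler_sqr ?nnegrE //; last by apply: mulr_ge0 => //; exact: ltW.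
by apply: le_trans (le_norm_sinh y); rewrite ler_piMl.
Qed.

Lemma cmod_csin_sub_le z : `|complex.Re z| <= 4 -> `|complex.Im z| <= 4 ->
  cmod (csin z - z) <= 2 * expR 4 ^+ 2 * cmod z ^+ 3.
Proof.
case: z => x y /= x4 y4; set z := _ +i* _; set K : R := expR 4.
have K1 : 1 <= K by rewrite -(expR0 R) ler_expR.
have rx : `|x| <= cmod z by exact: (cmod_Re z).
have ry : `|y| <= cmod z by exact: (cmod_Im z).
set r := cmod z in rx ry *.
have x0 := normr_ge0 x; have y0 := normr_ge0 y.
rewrite csinE.
have tri (u v : R) : cmod (u +i* v) <= `|u| + `|v|.
  rewrite [_ +i* _]complexE /=; apply: le_trans (cmodD _ _) _.
  by rewrite cmodM cmod_i mul1r !cmod_real.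
have -> : (sin x * cosh y +i* (cos x * sinh y) - z) =
   (sin x * cosh y - x) +i* (cos x * sinh y - y) by [].
apply: le_trans (tri _ _) _.
have r0 : 0 <= r by apply: le_trans rx.
have K2 : K <= K ^+ 2 by rewrite expr2 ler_peMl // (le_trans _ K1).
have xr2 : `|x| ^+ 2 <= r ^+ 2 by rewrite lerXn2r.
have yr2 : `|y| ^+ 2 <= r ^+ 2 by rewrite lerXn2r.
have xr3 : `|x| ^+ 3 <= r ^+ 3 by rewrite lerXn2r.
have yr3 : `|y| ^+ 3 <= r ^+ 3 by rewrite lerXn2r.
have r30 : 0 <= r ^+ 3 by rewrite exprn_ge0.
have xyr : `|x| * `|y| ^+ 2 <= r ^+ 3 by rewrite [r ^+ 3]exprS ler_pM ?exprn_ge0.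
have yxr : `|x| ^+ 2 * `|y| <= r ^+ 3 by rewrite [r ^+ 3]exprSr ler_pM ?exprn_ge0.
have c1 : `|cosh y| <= K by rewrite ger0_norm ?cosh_le // (le_trans _ (cosh_ge1 y)).
have e1 : `|sin x * cosh y - x| <= K ^+ 2 * r ^+ 3.
  have -> : sin x * cosh y - x = (sin x - x) * cosh y + x * (cosh y - 1) by ring.
  apply: le_trans (ler_normD _ _) _; rewrite (normrM (sin x - x)) (normrM x).
  have h1 : `|sin x - x| * `|cosh y| <= (r ^+ 3 / 2) * K ^+ 2.
    apply: ler_pM => //; last exact: le_trans K2.
    by apply: le_trans (sin_sub_le x) _; rewrite ler_wpM2r.
  have h2 : `|x| * `|cosh y - 1| <= K ^+ 2 * r ^+ 3 / 2.
    apply: (@le_trans _ _ (`|x| * (K ^+ 2 * y ^+ 2 / 2))).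
      by rewrite ler_wpM2l // cosh_sub1_le.
    rewrite -(real_normK (num_real y)).
    have -> : `|x| * (K ^+ 2 * `|y| ^+ 2 / 2) = K ^+ 2 * (`|x| * `|y| ^+ 2) / 2 by ring.
    by rewrite ler_wpM2r // ler_wpM2l // exprn_ge0 // (le_trans _ K1).
  lra.
have e2 : `|cos x * sinh y - y| <= K ^+ 2 * r ^+ 3.
  have -> : cos x * sinh y - y = (cos x - 1) * sinh y + (sinh y - y) by ring.
  apply: le_trans (ler_normD _ _) _; rewrite (normrM (cos x - 1)).
  have h1 : `|cos x - 1| * `|sinh y| <= K ^+ 2 * r ^+ 3 / 2.
    apply: (@le_trans _ _ ((`|x| ^+ 2 / 2) * (K * `|y|))).
      by rewrite ler_pM // ?norm_sinh_le // real_normK ?num_real // cos_sub1_le.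
    have -> : `|x| ^+ 2 / 2 * (K * `|y|) = K * (`|x| ^+ 2 * `|y|) / 2 by ring.
    by rewrite ler_wpM2r // ler_pM // ?mulr_ge0 ?exprn_ge0 // (le_trans _ K1).
  have h2 : `|sinh y - y| <= K ^+ 2 * r ^+ 3 / 2.
    apply: le_trans (sinh_sub_le y4) _.
    by rewrite ler_wpM2r // ler_wpM2l // exprn_ge0 // (le_trans _ K1).
  lra.
lra.
Qed.

End ComplexSine.

(** * Partial fractions of the squared cosecant *)

Section PartialFractions.
Variable R : realType.
Implicit Types z w : R[i].

Lemma Re_realM (x : R) z : complex.Re (x%:C * z) = x * complex.Re z.
Proof. by case: z => a b /=; rewrite mul0r subr0. Qed.

Lemma Im_realM (x : R) z : complex.Im (x%:C * z) = x * complex.Im z.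
Proof. by case: z => a b /=; rewrite mul0r addr0. Qed.

(** This is pi^2 / sin^2 (pi z), see [cscsqE], written in the exponential that
    occurs in the q-series: the summand of the q-series at w q^m is this function
    at u + m tau, up to the factor (2 pi i)^2. *)
Definition cscsq z : R[i] :=
  (2 * (pi : R)%:C * 'i%C) ^+ 2 * (qexp z / (1 - qexp z) ^+ 2).

Lemma qexp_sqr z : qexp z = cexp ('i%C * ((pi : R)%:C * z)) ^+ 2.
Proof. by rewrite expr2 -cexpD /qexp; congr cexp; ring. Qed.

Lemma cscsqE z : cscsq z = (pi : R)%:C ^+ 2 / csin ((pi : R)%:C * z) ^+ 2.
Proof.
rewrite /cscsq qexp_sqr /csin cexpN.
have := cexp_neq0 ('i%C * ((pi : R)%:C * z)); set a := cexp _ => a0.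
have -> : (1 - a ^+ 2) ^+ 2 = a ^+ 2 * (a - a^-1) ^+ 2 by field.
have -> : a ^+ 2 / (a ^+ 2 * (a - a^-1) ^+ 2) = ((a - a^-1) ^+ 2)^-1.
  by rewrite invfM mulrA mulfV ?expf_neq0 // mul1r.
by rewrite expr_div_n invf_div mulrA; congr (_ * _); ring.
Qed.

(** After translation by an integer, |Re z| <= 1/2, and there the sine of pi z
    vanishes only at 0. *)
Lemma qexp_eq1 z : qexp z = 1 -> exists n : int, z = n%:~R.
Proof.
have p0 := pi_gt0 R.
pose n := Num.floor (complex.Re z + 1 / 2); move=> z1; exists n.
apply/eqP; rewrite -subr_eq0; set w := z - n%:~R.
have w1 : qexp w = 1 by rewrite /w -mulrNz qexpDint.
have rw : `|complex.Re w| <= 1 / 2.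
  have -> : complex.Re w = complex.Re z - n%:~R.
    by rewrite /w -(rmorph_int (real_complex R)); case: (z).
  have /andP[h1 h2] := floor_itv (complex.Re z + 1 / 2).
  by move: h1 h2; rewrite -/n intrD ler_norml => h1 h2; apply/andP; split; lra.
have sw : csin ((pi : R)%:C * w) = 0.
  rewrite /csin cexpN.
  have := cexp_neq0 ('i%C * ((pi : R)%:C * w)); move: w1; rewrite qexp_sqr.
  set a := cexp _ => a1 a0.
  by rewrite -[X in X - _](mulfK a0) -expr2 a1 mul1r subrr mul0r.
have : `|complex.Re ((pi : R)%:C * w)| <= 3 / 4 * pi.
  by rewrite Re_realM normrM (ger0_norm (ltW p0)); nra.
move/cmod_csin_ge; rewrite sw cmod0 (pmulr_rle0 _ (sin_slope_gt0 R)).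
rewrite cmodM cmod_real (ger0_norm (ltW p0)) (pmulr_rle0 _ p0) => h.
by rewrite -cmod_eq0 eq_le h cmod_ge0.
Qed.

Definition nonint z := forall n : int, z <> n%:~R.

(** With a = exp (pi i z) this is the identity
    a / (1 - a)^2 - a / (1 + a)^2 = 4 a^2 / (1 - a^2)^2. *)
Lemma cscsq_double z : nonint z ->
  cscsq z = (cscsq (z / 2) + cscsq ((z + 1) / 2)) / 4.
Proof.
move=> zZ; have n1 : qexp z != 1 by apply/eqP => /qexp_eq1 [n /zZ].
rewrite (mulrDl z 1) /cscsq qexpD qexp_half.
have : qexp z = qexp (z / 2) ^+ 2 by rewrite expr2 -qexpD -splitr.
move: n1 => /[swap] ->; set a := qexp _ => a1.
have h1 : 1 - a ^+ 2 != 0 by rewrite subr_eq0 eq_sym.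
have fac : 1 - a ^+ 2 = (1 - a) * (1 + a) by ring.
have /andP[h2 h3] : (1 - a != 0) && (1 + a != 0).
  by rewrite -negb_or -mulf_eq0 -fac.
by field; rewrite h1 h2 !mulrN1 opprK h3 /=.
Qed.

Lemma nonintD z (n : int) : nonint z -> nonint (z + n%:~R).
Proof.
by move=> zZ m h; apply: (zZ (m - n)); rewrite intrB -h addrK.
Qed.

Lemma cscsqDint z (n : int) : cscsq (z + n%:~R) = cscsq z.
Proof. by rewrite /cscsq qexpDint. Qed.

(** Iteration of [cscsq_double]: the two halves of the point of index j at level k
    are the points of index j and j + 2^k at level k + 1. *)
Lemma cscsq_multiplication (k : nat) z : nonint z ->
  cscsq z = (\sum_(0 <= j < 2 ^ k) cscsq ((z + j%:R) / (2 ^ k)%:R))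
    / (2 ^ k)%:R ^+ 2.
Proof.
move=> zZ; elim: k => [|k IH].
  by rewrite expn0 big_nat1 addr0 expr1n !divr1.
have P0 : (2 ^ k)%:R != 0 :> R[i] by rewrite pnatr_eq0 expn_eq0.
rewrite IH {IH} expnS mul2n -addnn [in RHS](big_cat_nat (n := 2 ^ k)) ?leq_addr //=.
rewrite [X in _ = (_ + X) / _ ](big_addn 0 (2 ^ k + 2 ^ k) (2 ^ k)) addnK -big_split /=.
have -> : (2 ^ k + 2 ^ k)%:R ^+ 2 = 4 * (2 ^ k)%:R ^+ 2 :> R[i].
  by rewrite natrD; ring.
rewrite (invfM 4) mulrA; congr (_ / _); rewrite mulr_suml; apply: eq_bigr => j _.
rewrite cscsq_double.
  by congr ((cscsq _ + cscsq _) / 4); rewrite !natrD; field; rewrite P0 -?natrD ?addnn -?mul2n ?pnatr_eq0 ?muln_eq0 ?expn_eq0.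
move=> n /(canRL (divfK P0)) h; apply: (zZ (n * (2 ^ k)%N - j%:Z)).
by rewrite intrB intrM -[RHS]/(_ - j%:R) -h addrK.
Qed.

(** The difference is (w^2 - sin^2 w) / (w^2 sin^2 w) times pi^2, with w = pi z.
    The factor w - sin w is of order 3, w + sin w is of order 1, and the
    denominator is at least a multiple of |w|^4. *)
Lemma cscsq_pole_bound : exists C : R, forall z, z != 0 ->
  `|complex.Re z| <= 3 / 4 -> `|complex.Im z| <= 1 ->
  cmod (cscsq z - 1 / z ^+ 2) <= C.
Proof.
have p0 := pi_gt0 R; have p4 : (pi : R) <= 4 by have := pihalf_lt2 R; lra.
pose K : R := 2 * expR 4 ^+ 2; pose c := sin_slope R; have c0 : 0 < c := sin_slope_gt0 R.
have K0 : 0 <= K by rewrite mulr_ge0 // exprn_ge0 // expR_ge0.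
exists (pi ^+ 2 * (K * (2 + 64 * K) / c ^+ 2)) => z z0 rz iz.
pose w := (pi : R)%:C * z.
have pC0 : (pi : R)%:C != 0 by rewrite -(rmorph0 (real_complex R)) (inj_eq (@complexI R)) gt_eqF.
have w0 : w != 0 by rewrite mulf_neq0.
have rwE : complex.Re w = pi * complex.Re z.
  exact: Re_realM.
have iwE : complex.Im w = pi * complex.Im z.
  exact: Im_realM.
have rw : `|complex.Re w| <= 3 / 4 * pi.
  by rewrite rwE normrM (ger0_norm (ltW p0)) mulrC ler_wpM2r // ltW.
have iw : `|complex.Im w| <= 4.
  by rewrite iwE normrM (ger0_norm (ltW p0)) (le_trans _ p4) // ler_piMr // ltW.
have rw4 : `|complex.Re w| <= 4 by apply: le_trans rw _; lra.
have r8 : cmod w <= 8.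
  rewrite [w]complexE; apply: le_trans (cmodD _ _) _.
  by rewrite cmodM cmod_i mul1r !cmod_real; lra.
have r0 : 0 < cmod w by rewrite cmod_gt0.
have lo := cmod_csin_ge rw.
have up := cmod_csin_sub_le rw4 iw.
have s0 : csin w != 0.
  by rewrite -cmod_gt0 (lt_le_trans _ lo) // mulr_gt0.
have -> : cscsq z - 1 / z ^+ 2 =
    (pi : R)%:C ^+ 2 * ((w - csin w) * (w + csin w) / (csin w ^+ 2 * w ^+ 2)).
  have gen (P s : R[i]) : P != 0 -> s != 0 -> P ^+ 2 / s ^+ 2 - 1 / z ^+ 2 =
      P ^+ 2 * ((P * z - s) * (P * z + s) / (s ^+ 2 * (P * z) ^+ 2)).
    by move=> P0 s00; field; rewrite z0 P0 s00.
  by rewrite cscsqE gen.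
rewrite cmodM (cmodX _ 2) cmod_real (ger0_norm (ltW p0)).
apply: ler_wpM2l; first by rewrite exprn_ge0 // ltW.
rewrite cmodM cmodV (cmodM (w - csin w)) (cmodM (csin w ^+ 2)) !cmodX (cmodC w).
set r := cmod w in r8 r0 lo up *; set s := cmod (csin w) in lo *.
have r64 : r ^+ 2 <= 64 by rewrite expr2; nra.
have wps : cmod (w + csin w) <= (2 + 64 * K) * r.
  rewrite (_ : w + csin w = (w + w) + (csin w - w)); last by ring.
  apply: le_trans (cmodD _ _) _.
  have := cmodD w w; rewrite -/r.
  have : K * r ^+ 3 <= K * (64 * r) by rewrite ler_wpM2l // exprSr ler_wpM2r // ltW.
  rewrite -/K in up; lra.
have crs : (c * r) ^+ 2 <= s ^+ 2.
  by rewrite lerXn2r ?nnegrE ?cmod_ge0 // mulr_ge0 // ltW.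
have s2 : 0 < s ^+ 2 * r ^+ 2 by rewrite mulr_gt0 ?exprn_gt0 // /s cmod_gt0.
rewrite ler_pdivrMr //.
apply: (@le_trans _ _ ((K * r ^+ 3) * ((2 + 64 * K) * r))).
  by rewrite ler_pM ?cmod_ge0.
apply: (@le_trans _ _ (K * (2 + 64 * K) / c ^+ 2 * ((c * r) ^+ 2 * r ^+ 2))).
  rewrite le_eqVlt; apply/orP; left; apply/eqP; field.
  by rewrite gt_eqF.
apply: ler_wpM2l.
  apply: divr_ge0; last by rewrite exprn_ge0 // ltW.
  by apply: mulr_ge0 => //; lra.
by apply: ler_wpM2r => //; rewrite exprn_ge0 // ltW.
Qed.

(** With N = 2^(k+1), the N terms of the multiplication formula at the points
    (z + n) / N, for n in the window from - N/2 to N/2 - 1, differ from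
    N^2 / (z + n)^2 by at most C each. After division by N^2 the total error is at
    most C / N. The bound on z keeps all these points in the region of
    [cscsq_pole_bound]. *)
Lemma cscsq_window (k : nat) z (C : R) : nonint z ->
  (forall w, w != 0 -> `|complex.Re w| <= 3 / 4 -> `|complex.Im w| <= 1 ->
    cmod (cscsq w - 1 / w ^+ 2) <= C) ->
  4 * cmod z <= (2 ^ k.+1)%:R ->
  cmod (\sum_(j <- iota 0 (2 ^ k.+1)) 1 / (z + (j%:Z - (2 ^ k)%N%:Z)%:~R) ^+ 2
        - cscsq z) <= C / (2 ^ k.+1)%:R.
Proof.
move=> zZ HC zk; set N := (2 ^ k.+1)%N.
have N0 : N%:R != 0 :> R[i] by rewrite pnatr_eq0 expn_eq0.
have N0' : 0 < N%:R :> R by rewrite ltr0n expn_gt0.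
have NE : N%:R = 2 * (2 ^ k)%:R :> R by rewrite /N expnS natrM.
pose y := z + (- (2 ^ k)%N%:Z)%:~R.
have yZ : nonint y by apply: nonintD.
have yj (j : nat) : y + j%:R != 0.
  by apply/eqP => h; apply: ((nonintD (n := j) yZ) 0); rewrite -pmulrn h.
rewrite -(cscsqDint z (- (2 ^ k)%N%:Z)) -/y (cscsq_multiplication k.+1 yZ) -/N.
have -> : \sum_(j <- iota 0 N) 1 / (z + (j%:Z - (2 ^ k)%N%:Z)%:~R) ^+ 2 =
    (\sum_(0 <= j < N) 1 / ((y + j%:R) / N%:R) ^+ 2) / N%:R ^+ 2.
  rewrite mulr_suml /index_iota subn0; apply: eq_bigr => j _.
  have -> : z + (j%:Z - (2 ^ k)%N%:Z)%:~R = y + j%:R.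
    by rewrite /y intrD -addrA [X in z + X]addrC.
  by field; rewrite N0 yj.
rewrite -mulrBl -sumrB cmodM cmodV cmodX cmod_nat.
rewrite ler_pdivrMr ?exprn_gt0 //.
have -> : C / N%:R * N%:R ^+ 2 = C * N%:R by field; rewrite gt_eqF.
apply: le_trans (cmod_sum _ _) _.
have -> : C * N%:R = \sum_(0 <= j < N) C by rewrite sumr_const_nat subn0 mulr_natr.
rewrite [leLHS]big_nat_cond [leRHS]big_nat_cond.
apply: ler_sum => j; rewrite andbT => /andP[_ jN]; rewrite cmodC.
have jN' : j%:R <= N%:R :> R by rewrite ler_nat ltnW.
have j0 : 0 <= j%:R :> R by [].
have yjE : (y + j%:R) / N%:R =
    (N%:R^-1)%:C * (z + (j%:R - (2 ^ k)%:R)%:C).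
  rewrite fmorphV rmorphB !rmorph_nat mulrC /y mulrNz -pmulrn; congr (_ * _).
  by rewrite -addrA [X in z + X]addrC.
have reE : complex.Re ((y + j%:R) / N%:R) = (complex.Re z + (j%:R - (2 ^ k)%:R)) / N%:R.
  by rewrite yjE Re_realM mulrC; case: (z).
have imE : complex.Im ((y + j%:R) / N%:R) = complex.Im z / N%:R.
  by rewrite yjE Im_realM mulrC; case: (z) => a b /=; rewrite addr0.
have := cmod_Re z; have := cmod_Im z; rewrite !ler_norml => /andP[i1 i2] /andP[r1 r2].
apply: HC.
- by rewrite mulf_neq0 ?invr_eq0 //.
- rewrite reE normrM normfV normr_nat ler_pdivrMr // ler_norml.
  by apply/andP; split; lra.
- rewrite imE normrM normfV normr_nat ler_pdivrMr // mul1r ler_norml.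
  by apply/andP; split; lra.
Qed.

(** Absolute summability gives some unordered sum, and the windows, which exhaust
    the integers, identify it. *)
Lemma sums_to_cscsq z M : nonint z ->
  abs_bounded (fun n : int => 1 / (z + n%:~R) ^+ 2) M ->
  sums_to (fun n : int => 1 / (z + n%:~R) ^+ 2) (cscsq z).
Proof.
move=> zZ /abs_bounded_sums_to [s xs]; suff -> : cscsq z = s by [].
apply/eqP; rewrite -subr_eq0 -cmod_eq0; apply/eqP/le_anti.
rewrite cmod_ge0 andbT; apply/ler_addgt0Pl => e e0; rewrite addr0.
have e20 : 0 < e / 2 by rewrite divr_gt0.
have [s0 H] := xs _ e20; have [C HC] := cscsq_pole_bound.
(* k makes the window contain s0, meets the condition on z, and makes the
   error at most e / 2. *)
pose k := (\max_(n <- s0) `|n|%N + Num.Def.truncn (4 * cmod z) + Num.Def.truncn (`|C| / (e / 2)))%N.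
have kk : (k < 2 ^ k)%N by apply: ltn_expl.
have kk1 : (2 ^ k < 2 ^ k.+1)%N by rewrite ltn_exp2l.
have zk : 4 * cmod z <= (2 ^ k.+1)%:R.
  apply: ltW; apply: lt_le_trans (truncnS_gt _) _; rewrite ler_nat.
  by apply: leq_ltn_trans kk1; apply: leq_trans (ltnW kk); rewrite /k -addnA addnCA leq_addr.
have Ck : C / (2 ^ k.+1)%:R <= e / 2.
  rewrite ler_pdivrMr ?ltr0n ?expn_gt0 // mulrC -ler_pdivrMr //.
  apply: (@le_trans _ _ (`|C| / (e / 2))).
    by rewrite ler_wpM2r ?ler_norm // invr_ge0 ltW.
  apply: ltW; apply: lt_le_trans (truncnS_gt _) _; rewrite ler_nat.
  by apply: leq_ltn_trans kk1; apply: leq_trans (ltnW kk); rewrite /k leq_addl.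
have := cscsq_window zZ HC zk => h1.
pose t := [seq j%:Z - (2 ^ k)%N%:Z | j <- iota 0 (2 ^ k.+1)].
have ut : uniq t.
  by rewrite map_inj_uniq ?iota_uniq // => a b; lia.
have st : {subset s0 <= t}.
  move=> n ns; have nk : (`|n| < 2 ^ k)%N.
    apply: leq_ltn_trans kk; rewrite /k -addnA.
    by apply: leq_trans (leq_addr _ _); exact: (leq_bigmax_seq (F := fun n : int => `|n|%N)).
  apply/mapP; exists (absz (n + (2 ^ k)%N%:Z)); last by lia.
  by rewrite mem_iota expnS; lia.
have := H t ut st; rewrite big_map => h2.
move: h1 h2; set S := \sum_(_ <- _) _ => h1 h2.
rewrite (_ : cscsq z - s = (S - s) - (S - cscsq z)); last by ring.
by have := cmodB (S - s) (S - cscsq z); lra.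
Qed.

(** This decay in the imaginary direction makes the sums over the rows of the
    lattice summable. *)
Lemma cscsq_le_Im z : complex.Im z != 0 -> cmod (cscsq z) <= (complex.Im z ^+ 2)^-1.
Proof.
move=> iz; have p0 := pi_gt0 R.
rewrite cscsqE cmodM cmodV !cmodX cmod_real (ger0_norm (ltW p0)).
have h : pi * `|complex.Im z| <= cmod (csin ((pi : R)%:C * z)).
  apply: le_trans (cmod_csin_ge_Im _).
  by rewrite Im_realM normrM ger0_norm // ltW.
have i0 : 0 < `|complex.Im z| by rewrite normr_gt0.
have pi0 : 0 < pi * `|complex.Im z| by rewrite mulr_gt0.
rewrite ler_pdivrMr; last by rewrite exprn_gt0 // (lt_le_trans pi0).
rewrite -(real_normK (num_real (complex.Im z))) mulrC ler_pdivlMr ?exprn_gt0 //.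
by rewrite -exprMn lerXn2r ?nnegrE ?cmod_ge0 // ltW.
Qed.

End PartialFractions.

(** * Summable weights on the integers and on pairs of integers *)

Section LatticeWeights.
Variable R : realType.

(** The weight is sqrt (max 1 |n|), so that the product of the weights of two
    coordinates is at most the larger of max 1 |m| and max 1 |n|. Hence 1 / |lambda|^3
    is dominated on the lattice by the product [pwt3] of two summable weights. *)
Definition wt (n : int) : R := Num.sqrt (maxn 1 `|n|)%:R.

Lemma wt_ge1 n : 1 <= wt n.
Proof. by rewrite -[leLHS]sqrtr1 ler_wsqrtr // ler1n leq_max. Qed.

Lemma wt_gt0 n : 0 < wt n.
Proof. exact: lt_le_trans (wt_ge1 n). Qed.

Lemma wt_sqr n : wt n ^+ 2 = (maxn 1 `|n|)%:R.
Proof. by rewrite sqr_sqrtr. Qed.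

Definition wt3 (n : int) : R := (wt n ^+ 3)^-1.

Lemma wt3_ge0 n : 0 <= wt3 n.
Proof. by rewrite invr_ge0 exprn_ge0 // ltW // wt_gt0. Qed.

(** With a and b the two roots, b^2 - a^2 = 1 turns the difference of inverses
    into 1 / (a b (a + b)), and b <= 2 a. *)
Lemma sqrt_telescope (n : nat) : (0 < n)%N ->
  (Num.sqrt n%:R ^+ 3)^-1 <= 6 * ((Num.sqrt n%:R)^-1 - (Num.sqrt n.+1%:R)^-1) :> R.
Proof.
move=> n0; set a : R := Num.sqrt n%:R; set b : R := Num.sqrt n.+1%:R.
have a2 : a ^+ 2 = n%:R by rewrite sqr_sqrtr.
have b2 : b ^+ 2 = n%:R + 1 by rewrite sqr_sqrtr // natr1.
have n1 : 1 <= n%:R :> R by rewrite ler1n.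
have a0 : 0 < a by rewrite sqrtr_gt0; lra.
have b0 : 0 < b by rewrite sqrtr_gt0.
(* n >= 1, so n + 1 <= 4 n. *)
have ab : b <= 2 * a.
  rewrite -ler_sqr ?nnegrE ?ltW //; last by lra.
  by rewrite exprMn a2 b2; lra.
have -> : 6 * (a^-1 - b^-1) = 6 / (a * b * (a + b)).
  have e : b ^+ 2 - a ^+ 2 = 1 by rewrite a2 b2; ring.
  rewrite -[in RHS](mulr1 6) -e; field.
  by rewrite !gt_eqF // addr_gt0.
have ab0 : 0 < a * b * (a + b) by rewrite !mulr_gt0 ?addr_gt0.
rewrite ler_pdivlMr // mulrC ler_pdivrMr ?exprn_gt0 //.
have h1 : a * b <= 2 * a ^+ 2 by rewrite expr2; nra.
have h2 : a + b <= 3 * a by lra.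
apply: (@le_trans _ _ (2 * a ^+ 2 * (3 * a))).
  by apply: ler_pM => //; rewrite ?mulr_ge0 ?addr_ge0 // ltW.
by rewrite le_eqVlt; apply/orP; left; apply/eqP; ring.
Qed.

Lemma sum_wt3_nat (N : nat) : \sum_(j <- iota 0 N) wt3 j%:Z <= 7.
Proof.
case: N => [|N]; first by rewrite big_nil.
rewrite /= big_cons.
have -> : wt3 0 = 1 by rewrite /wt3 /wt /= sqrtr1 expr1n invr1.
have : \sum_(j <- iota 1 N) wt3 j <=
    \sum_(1 <= j < N.+1) 6 * ((Num.sqrt j%:R)^-1 - (Num.sqrt j.+1%:R)^-1).
  rewrite /index_iota subn1 /= big_seq [leRHS]big_seq; apply: ler_sum => j.
  rewrite mem_iota => /andP[j1 _]; apply: le_trans (sqrt_telescope j1).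
  by rewrite /wt3 /wt /= (maxn_idPr j1).
rewrite -mulr_sumr.
have -> : \sum_(1 <= j < N.+1) ((Num.sqrt j%:R)^-1 - (Num.sqrt j.+1%:R)^-1) =
    1 - (Num.sqrt N.+1%:R)^-1 :> R.
  elim: N => [|N IH]; first by rewrite big_geq // sqrtr1 invr1 subrr.
  by rewrite big_nat_recr //= IH; ring.
have : 0 <= (Num.sqrt N.+1%:R)^-1 :> R by rewrite invr_ge0 sqrtr_ge0.
lra.
Qed.

Lemma sum_wt3 (t : seq int) : uniq t -> \sum_(n <- t) wt3 n <= 14.
Proof.
move=> ut.
have half (p : pred int) : {in p &, injective absz} ->
    \sum_(n <- [seq n <- t | p n]) wt3 n <= 7.
  move=> pinj; pose N := (\max_(n <- t) `|n|%N).+1.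
  have -> : \sum_(n <- [seq n <- t | p n]) wt3 n =
      \sum_(j <- [seq absz n | n <- t & p n]) wt3 j%:Z.
    by rewrite big_map; apply: eq_bigr => n _; rewrite /wt3 /wt absz_nat.
  apply: le_trans (sum_wt3_nat N).
  apply: ler_sum_subset; rewrite ?iota_uniq //.
  - by move=> j; apply: wt3_ge0.
  - rewrite map_inj_in_uniq ?filter_uniq // => a b.
    by rewrite !mem_filter => /andP[pa _] /andP[pb _]; apply: pinj.
  - move=> j /mapP[n]; rewrite mem_filter => /andP[_ nt] ->.
    rewrite mem_iota /= add0n ltnS.
    exact: (leq_bigmax_seq (F := fun n : int => `|n|%N)).
have -> : \sum_(n <- t) wt3 n = \sum_(n <- [seq n <- t | 0 <= n]) wt3 n
    + \sum_(n <- [seq n <- t | ~~ (0 <= n)]) wt3 n.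
  by rewrite !big_filter (bigID (fun n : int => 0 <= n)).
have := half (fun n : int => 0 <= n); have := half (fun n : int => ~~ (0 <= n)).
have i1 : {in (fun n : int => 0 <= n) &, injective absz}.
  by move=> a b; rewrite -!topredE /=; lia.
have i2 : {in (fun n : int => ~~ (0 <= n)) &, injective absz}.
  by move=> a b; rewrite -!topredE /=; lia.
move=> /(_ i2) h1 /(_ i1) h2; lra.
Qed.

Definition pwt3 (p : int * int) : R := wt3 p.1 * wt3 p.2.

Lemma pwt3_ge0 p : 0 <= pwt3 p.
Proof. by rewrite mulr_ge0 ?wt3_ge0. Qed.

Lemma abs_bounded_wt3 : abs_bounded (fun n => (wt3 n)%:C) 14.
Proof.
move=> t ut; apply: le_trans (sum_wt3 ut).
by apply: ler_sum => n _; rewrite cmod_real ger0_norm ?wt3_ge0.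
Qed.

Lemma abs_bounded_pwt3 : abs_bounded (fun p => (pwt3 p)%:C) (14 * 14).
Proof.
move=> t ut.
pose A := undup (map fst t); pose B := undup (map snd t).
apply: (@le_trans _ _ (\sum_(p <- [seq (i, j) | i <- A, j <- B]) pwt3 p)).
  rewrite (eq_bigr pwt3) => [|p _]; last by rewrite cmod_real ger0_norm ?pwt3_ge0.
  apply: ler_sum_subset => //; first exact: pwt3_ge0.
    by apply: allpairs_uniq; rewrite ?undup_uniq // => -[a b] [c d].
  move=> [i j] ij; apply/allpairsP; exists (i, j).
  by rewrite !mem_undup; split => //; apply/mapP; exists (i, j).
rewrite big_allpairs_dep /pwt3 /=.
under eq_bigr do rewrite -mulr_sumr.
rewrite -mulr_suml ler_pM ?sum_wt3 ?undup_uniq ?sumr_ge0 // => i _; exact: wt3_ge0.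
Qed.

End LatticeWeights.

(** * Estimates for lattice points *)

Section LatticePoints.
Variable R : realType.
Implicit Types z u : R[i].

(** At most one point lies within c / 2 of z. If there is such a point other than
    z, every other point is at distance at least the distance of that one; so
    the distances to z have a positive lower bound, and the triangle inequality
    upgrades it to a bound linear in the size of the points. *)
Lemma separated_dist (I : eqType) (L : I -> R[i]) (c : R) z : 0 < c ->
  (forall p q, p != q -> c <= cmod (L p - L q)) ->
  exists2 d : R, 0 < d &
    forall p, L p != z -> d * (1 + cmod (L p)) <= cmod (z - L p).
Proof.
move=> c0 sep.
have [d0 d00 Hd0] : exists2 d0 : R, 0 < d0 &
    forall p, L p != z -> d0 <= cmod (z - L p).
  have [[q qz qc]|near] := pselect (exists2 q, L q != z & cmod (z - L q) < c / 2).
    exists (cmod (z - L q)); first by rewrite cmod_gt0 subr_eq0 eq_sym.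
    move=> p pz; have [->//|pq] := eqVneq p q.
    have := sep _ _ pq; have := cmodB (z - L q) (z - L p).
    rewrite (_ : z - L q - (z - L p) = L p - L q); last by ring.
    lra.
  exists (c / 2); first by rewrite divr_gt0.
  by move=> p pz; rewrite leNgt; apply/negP => h; apply: near; exists p.
pose D := (1 + cmod z) / d0 + 1.
have D0 : 0 < D by rewrite ltr_wpDl // divr_ge0 ?addr_ge0 ?cmod_ge0 // ltW.
exists D^-1; first by rewrite invr_gt0.
move=> p /Hd0 h; rewrite mulrC ler_pdivrMr // /D.
set r := cmod (z - L p) in h *.
have h1 : 1 + cmod z <= r * ((1 + cmod z) / d0).
  rewrite mulrA ler_pdivlMr // mulrC ler_wpM2r ?addr_ge0 ?cmod_ge0 //.
have := cmod_le_triangle (L p) z; rewrite (cmodC (L p)) -/r mulrDr mulr1; lra.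
Qed.

Variable tau : R[i].
Hypothesis tau_gt0 : 0 < complex.Im tau.
Local Notation L := (lattice_point tau).

Definition lattice_const : R := (1 + cmod tau) / complex.Im tau + 1.

Lemma lattice_const_gt0 : 0 < lattice_const.
Proof.
by rewrite ltr_wpDl // divr_ge0 ?addr_ge0 ?cmod_ge0 // ltW.
Qed.

Lemma Im_lattice_point p : complex.Im (L p) = p.1%:~R * complex.Im tau.
Proof.
rewrite /lattice_point -!(rmorph_int (real_complex R)).
by case: tau => a b /=; rewrite mul0r addr0 addr0.
Qed.

(** The first coordinate is read from the imaginary part, and the second one
    from what remains. *)
Lemma lattice_coord_le p :
  `|p.1|%:~R <= lattice_const * cmod (L p) /\ `|p.2|%:~R <= lattice_const * cmod (L p).
Proof.
have t0 := tau_gt0.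
have h1 : `|p.1|%:~R * complex.Im tau <= cmod (L p).
  by have := cmod_Im (L p); rewrite Im_lattice_point normrM intr_norm (ger0_norm (ltW t0)).
have h2 : `|p.2|%:~R <= cmod (L p) + `|p.1|%:~R * cmod tau.
  rewrite -!cmod_int -cmodM.
  have -> : p.2%:~R = L p - p.1%:~R * tau by rewrite /lattice_point addrAC subrr add0r.
  exact: cmodB.
have {}h1 : `|p.1|%:~R <= cmod (L p) / complex.Im tau by rewrite ler_pdivlMr.
set r := cmod (L p) in h1 h2 *.
have r0 : 0 <= r := cmod_ge0 _; have ct := cmod_ge0 tau.
have rt : 0 <= r / complex.Im tau by rewrite divr_ge0 // ltW.
have e : lattice_const * r = r / complex.Im tau + (r / complex.Im tau) * cmod tau + r.
  by rewrite /lattice_const; field; rewrite gt_eqF.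
have m1 : `|p.1|%:~R * cmod tau <= r / complex.Im tau * cmod tau by rewrite ler_wpM2r.
have m2 : 0 <= r / complex.Im tau * cmod tau by rewrite mulr_ge0.
by rewrite e; split; lra.
Qed.

(** Both coordinates, and 1 as well, are at most X = lattice_const |L p|, so each
    weight is at most the square root of X. *)
Lemma lattice_wt_le p : p != (0, 0) ->
  wt R p.1 * wt R p.2 <= lattice_const * cmod (L p).
Proof.
move=> p0; have [h1 h2] := lattice_coord_le p.
set X := _ * cmod _ in h1 h2 *.
have X1 : 1 <= X.
  have [m0|m0] := eqVneq p.1 0.
    apply: le_trans h2; rewrite ler1z -gtz0_ge1 normr_gt0.
    by apply: contraNneq p0; case: (p) m0 => a b /= -> ->.
  by apply: le_trans h1; rewrite ler1z -gtz0_ge1 normr_gt0.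
have X0 : 0 <= X by lra.
have aux (n : int) : `|n|%:~R <= X -> wt R n <= Num.sqrt X.
  move=> nX; rewrite ler_wsqrtr //; rewrite -natr_absz in nX.
  by case: (leqP `|n|%N 1).
rewrite -[X in _ <= X]sqr_sqrtr // expr2.
by rewrite ler_pM ?aux // ltW // wt_gt0.
Qed.

Lemma lattice_wt_le_1D p :
  wt R p.1 * wt R p.2 <= (lattice_const + 1) * (1 + cmod (L p)).
Proof.
have l0 := lattice_const_gt0; have c0 := cmod_ge0 (L p).
have [->|/lattice_wt_le h] := eqVneq p (0, 0).
  by have := cmod_ge0 (L (0, 0)); rewrite /wt /= sqrtr1 mulr1; nra.
by nra.
Qed.

Lemma pwt3E p : pwt3 R p = ((wt R p.1 * wt R p.2) ^+ 3)^-1.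
Proof. by rewrite /pwt3 /wt3 -invfM -exprMn. Qed.

Lemma lattice_point_neq0 p : p != (0, 0) -> L p != 0.
Proof.
move=> /lattice_wt_le h; rewrite -cmod_gt0.
rewrite -(pmulr_rgt0 _ lattice_const_gt0); apply: lt_le_trans h.
by rewrite mulr_gt0 ?wt_gt0.
Qed.

Lemma lattice_pointB p q : L p - L q = L (p.1 - q.1, p.2 - q.2).
Proof. by rewrite /lattice_point /= !intrB; ring. Qed.

Lemma lattice_sep p q : p != q -> lattice_const^-1 <= cmod (L p - L q).
Proof.
move=> pq; rewrite lattice_pointB.
have /lattice_wt_le : (p.1 - q.1, p.2 - q.2) != (0, 0).
  apply: contra pq => /eqP[/eqP]; rewrite subr_eq0 => /eqP pq1 /eqP.
  by rewrite subr_eq0 => /eqP pq2; case: p q pq1 pq2 => [a b] [c d] /= -> ->.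
move=> h; rewrite -(ler_pM2l lattice_const_gt0) mulfV ?gt_eqF ?lattice_const_gt0 //.
apply: le_trans h; rewrite -[leLHS]mulr1 ler_pM ?wt_ge1 //.
Qed.

Lemma lattice_point_inj : injective L.
Proof.
move=> p q pq; apply/eqP; apply/negP => /negP /lattice_sep.
by rewrite pq subrr cmod0 leNgt invr_gt0 lattice_const_gt0.
Qed.

Lemma lattice_dist z : exists2 d : R, 0 < d &
  forall p, L p != z -> d * (1 + cmod (L p)) <= cmod (z - L p).
Proof.
by apply: separated_dist lattice_sep; rewrite invr_gt0 lattice_const_gt0.
Qed.

End LatticePoints.

(** * Holomorphy of sums of series *)

Section Holomorphy.
Variable R : realType.
Implicit Types z u : R[i].

(** A quadratic bound on the remainder of the first-order expansion is stronger
    than differentiability, but unlike it passes to sums term by term; this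
    replaces the theorem on uniform limits of holomorphic functions. *)
Lemma quadratic_cderivable (f : R[i] -> R[i]) z (d : R[i]) (K r : R) :
  0 <= K -> 0 < r ->
  (forall h, cmod h <= r -> cmod (f (z + h) - f z - h * d) <= K * cmod h ^+ 2) ->
  cderivable f z.
Proof.
move=> K0 r0 H; apply/cvg_ex; exists (d : R[i]^o).
apply/cvgrPdist_le => e e0.
have [e' e'E] : exists e' : R, e = e'%:C.
  by exists (complex.Re e); rewrite RRe_real // gtr0_real.
move: e0; rewrite e'E ltcR => e0.
have K1 : 0 < K + 1 by rewrite ltr_wpDl.
pose s : R := Num.min r (e' / (K + 1)).
have s0 : 0 < s by rewrite lt_min r0 divr_gt0.
near=> h.
have h0 : h != 0 by near: h; exact: nbhs_dnbhs_neq.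
have : `|h| <= s%:C by near: h; apply: dnbhs0_le; rewrite ltcR.
rewrite cmodE lecR /s le_min => /andP[hr he].
rewrite /= -[h *: 1]/(h * 1) mulr1 -[_ *: _]/(_ * _) cmodE lecR cmodC.
have -> : h^-1 * (f (h + z) - f z) - d = h^-1 * (f (z + h) - f z - h * d).
  by rewrite [h + z]addrC !mulrBr mulKf.
rewrite cmodM cmodV mulrC ler_pdivrMr ?cmod_gt0 //.
apply: le_trans (H h hr) _; rewrite expr2 mulrA ler_wpM2r ?cmod_ge0 //.
move: he; rewrite ler_pdivlMr // => he.
by have := cmod_ge0 h; lra.
Unshelve. all: by end_near. Qed.

(** The sum of the D p is the derivative: the remainder of the sum is the sum of
    the remainders, and w is a summable majorant for all series involved, so that
    this remainder is again quadratic in h. *)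
Lemma csum_cderivable (I : choiceType) (f : I -> R[i] -> R[i]) (D : I -> R[i])
    z (K M r : R) (w : I -> R) : 0 <= K -> 0 < r ->
  (forall p, 0 <= w p) -> abs_bounded (fun p => (w p)%:C) M ->
  (forall p h, cmod h <= r -> cmod (f p (z + h)) <= K * w p) ->
  (forall p, cmod (D p) <= K * w p) ->
  (forall p h, cmod h <= r ->
     cmod (f p (z + h) - f p z - h * D p) <= K * cmod h ^+ 2 * w p) ->
  cderivable (fun u => csum (fun p => f p u)) z.
Proof.
move=> K0 r0 w0 wM fK DK remK.
have wE p : w p = cmod (w p)%:C by rewrite cmod_real ger0_norm.
have M0 : 0 <= M by have := wM [::] isT; rewrite big_nil.
have sf h : cmod h <= r -> exists s, sums_to (fun p => f p (z + h)) s.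
  move=> hr; apply: (@abs_bounded_sums_to _ _ _ (K * M)).
  by apply: abs_bounded_le wM => // p; rewrite -wE fK.
have [d sd] : exists d, sums_to D d.
  apply: (@abs_bounded_sums_to _ _ _ (K * M)).
  by apply: abs_bounded_le wM => // p; rewrite -wE DK.
apply: (@quadratic_cderivable _ _ d (K * M) r) => // [|h hr]; first by rewrite mulr_ge0.
have [s s1] := sf h hr.
have [s' s2] : exists s, sums_to (fun p => f p z) s.
  by have [|s'] := sf 0; rewrite ?cmod0 ?ltW // addr0; exists s'.
rewrite (sums_to_csum s1) (sums_to_csum s2).
have -> : K * M * cmod h ^+ 2 = K * cmod h ^+ 2 * M by ring.
apply: sums_to_le (sums_toB (sums_toB s1 s2) (sums_toZ h sd)).
apply: abs_bounded_le wM => [|p]; first by rewrite mulr_ge0 // exprn_ge0 // cmod_ge0.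
by rewrite -wE remK.
Qed.

End Holomorphy.

(** * The Weierstrass series near a point *)

Section WeierstrassP.
Variable R : realType.
Variable tau : R[i].
Hypothesis tau_gt0 : 0 < complex.Im tau.
Implicit Types z u : R[i].
Local Notation L := (lattice_point tau).

(** The double pole at the origin is treated as the term of index (0, 0), so that
    the function is one unordered sum. *)
Definition wp_term (p : int * int) u : R[i] :=
  if p == (0, 0) then 1 / u ^+ 2 else 1 / (u - L p) ^+ 2 - 1 / L p ^+ 2.

Lemma lattice_point0 : L (0, 0) = 0.
Proof. by rewrite /lattice_point /= mul0r addr0. Qed.

Lemma wp_termE p u :
  wp_term p u = 1 / (u - L p) ^+ 2 - (if p == (0, 0) then 0 else 1 / L p ^+ 2).
Proof.
by rewrite /wp_term; have [->|//] := eqVneq p (0, 0); rewrite lattice_point0 !subr0.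
Qed.

Lemma sums_to_wp u s : sums_to (fun p => wp_term p u) s -> wp u tau = s.
Proof.
move=> us; rewrite /wp (@sums_to_csum _ _ _ (s - 1 / u ^+ 2)); first by rewrite addrC subrK.
apply: eq_sums_to (sums_toB us (sums_to_single (0, 0) (1 / u ^+ 2))) => p.
by rewrite /wp_term; case: eqP => // _; rewrite ?subrr ?subr0.
Qed.

(** The term whose pole is the given point is dropped; the rest of the series is
    holomorphic near that point. *)
Definition wp_term_away z p u : R[i] := if L p == z then 0 else wp_term p u.

Definition wp_term_deriv z p u : R[i] :=
  if L p == z then 0 else - 2 / (u - L p) ^+ 3.

(** For u near z, every pole lambda other than z satisfies
    |u - lambda| >= (1 + |lambda|) / A. With q = 1 / (1 + |lambda|), the term, its
    derivative, and the remainder divided by h^2 are then at most a constant times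
    q^3, and q is at most a constant over the product of the two weights. For the term this uses
    1/(u - l)^2 - 1/l^2 = u (2 l - u) / ((u - l)^2 l^2), and for the remainder, with
    v = u - l, the formula
    h^2 (1 / (v^2 (v + h)^2) + 2 / (v^3 (v + h))). *)
Lemma wp_term_bounds z : exists K r : R, [/\ 0 <= K, 0 < r,
  forall p u, cmod (u - z) <= r -> cmod (wp_term_away z p u) <= K * pwt3 R p,
  forall p u, cmod (u - z) <= r -> cmod (wp_term_deriv z p u) <= K * pwt3 R p &
  forall p u h, cmod (u - z) <= r -> cmod (u + h - z) <= r ->
    cmod (wp_term_away z p (u + h) - wp_term_away z p u - h * wp_term_deriv z p u)
      <= K * cmod h ^+ 2 * pwt3 R p].
Proof.
have [d d0 Hd] := lattice_dist tau_gt0 z.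
have k0 := lattice_const_gt0 tau_gt0; set k := lattice_const tau in k0.
pose A := 2 / d; have A0 : 0 < A by rewrite divr_gt0.
(* E bounds the product of the weights times q, and U bounds |u| near z. *)
pose E := k + 1; have E0 : 0 < E by rewrite /E; lra.
pose U := cmod z + d / 2; have U0 : 0 <= U by rewrite addr_ge0 ?cmod_ge0 // divr_ge0 // ltW.
have near_pole p u : cmod (u - z) <= d / 2 -> L p != z ->
    u - L p != 0 /\ (cmod (u - L p))^-1 <= A * (1 + cmod (L p))^-1.
  move=> ur /Hd hp; have c0 := cmod_ge0 (L p).
  have hh : d / 2 * (1 + cmod (L p)) <= cmod (u - L p).
    have := cmodB (u - L p) (u - z).
    rewrite (_ : u - L p - (u - z) = z - L p); last by ring.
    nra.
  have q0 : 0 < d / 2 * (1 + cmod (L p)) by rewrite mulr_gt0 ?divr_gt0 //; lra.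
  split; first by rewrite -cmod_gt0 (lt_le_trans q0).
  have -> : A * (1 + cmod (L p))^-1 = (d / 2 * (1 + cmod (L p)))^-1.
    by rewrite invfM invf_div.
  by rewrite lef_pV2 ?posrE // (lt_le_trans q0).
have wtq p : (1 + cmod (L p))^-1 <= E * (wt R p.1 * wt R p.2)^-1.
  have w0 : 0 < wt R p.1 * wt R p.2 by rewrite mulr_gt0 ?wt_gt0.
  have c0 := cmod_ge0 (L p).
  rewrite ler_pdivlMr // mulrC ler_pdivrMr; last by lra.
  exact: (lattice_wt_le_1D tau_gt0).
pose q p := (1 + cmod (L p))^-1.
have q0 p : 0 < q p by rewrite invr_gt0; have := cmod_ge0 (L p); lra.
have q1 p : q p <= 1 by rewrite invf_le1; have := cmod_ge0 (L p); lra.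
have q3 p : q p ^+ 3 <= E ^+ 3 * pwt3 R p.
  rewrite pwt3E -exprVn -exprMn lerXn2r ?nnegrE ?wtq // ?ltW ?q0 //.
  by rewrite mulr_gt0 // invr_gt0 mulr_gt0 ?wt_gt0.
have w0 p : 0 <= pwt3 R p by exact: pwt3_ge0.
pose K1 := U * (2 + U) * A ^+ 2 * E ^+ 2.
have K10 : 0 <= K1.
  apply: mulr_ge0; last by rewrite exprn_ge0 // ltW.
  apply: mulr_ge0; last by rewrite exprn_ge0 // ltW.
  by apply: mulr_ge0 => //; lra.
have A2 : 0 < A ^+ 2 by rewrite exprn_gt0.
have A3 : 0 < A ^+ 3 by rewrite exprn_gt0.
have A4 : 0 < A ^+ 4 by rewrite exprn_gt0.
have E3 : 0 < E ^+ 3 by rewrite exprn_gt0.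
pose K := K1 + A ^+ 2 + 2 * A ^+ 3 + 3 * A ^+ 4.
have concl p (x K' : R) : 0 <= K' -> K' <= K -> x <= K' * q p ^+ 3 -> x <= K * E ^+ 3 * pwt3 R p.
  move=> K'0 K'K xq; apply: le_trans xq _; rewrite -mulrA.
  by apply: ler_pM => //; rewrite exprn_ge0 // ltW.
have qpos p : 0 <= q p := ltW (q0 p).
have KE0 : 0 <= K * E ^+ 3.
  by apply: mulr_ge0; [rewrite /K; lra|exact: ltW].
exists (K * E ^+ 3), (d / 2); split => [//||p u ur|p u ur|p u h ur uhr].
- by rewrite divr_gt0.
- rewrite /wp_term_away; case: (eqVneq (L p) z) => [_|pz].
    by rewrite cmod0 mulr_ge0.
  have [v0 vA] := near_pole p u ur pz.
  have vA2 : (cmod (u - L p))^-1 ^+ 2 <= (A * q p) ^+ 2.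
    by rewrite lerXn2r ?nnegrE ?invr_ge0 ?cmod_ge0 // mulr_ge0 // ltW.
  rewrite /wp_term; have [p0|p0] := eqVneq p (0, 0).
    apply: (concl p _ (A ^+ 2)); [exact: ltW|by rewrite /K; lra|].
    have q1' : q p = 1 by rewrite /q p0 lattice_point0 cmod0 addr0 invr1.
    move: vA2; rewrite q1' p0 lattice_point0 subr0 expr1n !mulr1 div1r.
    by rewrite cmodV cmodX exprVn.
  apply: (concl p _ K1) => //; first by rewrite /K; lra.
  have l0 := lattice_point_neq0 tau_gt0 p0.
  have -> : 1 / (u - L p) ^+ 2 - 1 / L p ^+ 2 =
      u * (L p + L p - u) * (u - L p)^-1 ^+ 2 * (L p)^-1 ^+ 2.
    by field; rewrite l0 v0.
  rewrite (cmodM _ ((L p)^-1 ^+ 2)) (cmodM _ ((u - L p)^-1 ^+ 2)) (cmodM u).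
  rewrite !cmodX !cmodV.
  have lc : 0 < cmod (L p) by rewrite cmod_gt0.
  have uU : cmod u <= U.
    by have := cmod_le_triangle u z; rewrite /U; lra.
  have lu : cmod (L p + L p - u) <= (2 + U) * (1 + cmod (L p)).
    have := cmodB (L p + L p) u; have := cmodD (L p) (L p); nra.
  have lE : (cmod (L p))^-1 <= E * q p.
    rewrite ler_pdivlMr; last by have := cmod_ge0 (L p); lra.
    rewrite mulrC ler_pdivrMr //.
    have : 1 <= k * cmod (L p).
      apply: le_trans (lattice_wt_le tau_gt0 p0).
      by rewrite -[leLHS]mulr1 ler_pM ?wt_ge1.
    by rewrite /E; lra.
  have lE2 : (cmod (L p))^-1 ^+ 2 <= (E * q p) ^+ 2.
    by rewrite lerXn2r ?nnegrE ?invr_ge0 ?cmod_ge0 // mulr_ge0 // ltW.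
  have -> : K1 * q p ^+ 3 =
      U * ((2 + U) * (1 + cmod (L p))) * (A * q p) ^+ 2 * (E * q p) ^+ 2.
    rewrite /K1 /q; field.
    by rewrite gt_eqF //; have := cmod_ge0 (L p); lra.
  by repeat apply: ler_pM; rewrite ?mulr_ge0 ?exprn_ge0 ?invr_ge0 ?cmod_ge0.
- rewrite /wp_term_deriv; case: (eqVneq (L p) z) => [_|pz].
    by rewrite cmod0 mulr_ge0.
  have [v0 vA] := near_pole p u ur pz.
  apply: (concl p _ (2 * A ^+ 3)); [lra|by rewrite /K; lra|].
  rewrite cmodM cmodN cmod_nat cmodV cmodX -exprVn -mulrA ler_wpM2l // -exprMn.
  by rewrite lerXn2r ?nnegrE ?invr_ge0 ?cmod_ge0 // mulr_ge0 // ltW.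
rewrite /wp_term_away /wp_term_deriv.
have h2 : 0 <= cmod h ^+ 2 by rewrite exprn_ge0 // cmod_ge0.
rewrite [K * E ^+ 3 * _]mulrC -[leRHS]mulrA.
case: (eqVneq (L p) z) => [_|pz].
  by rewrite mulr0 !subr0 cmod0; apply: mulr_ge0 => //; apply: mulr_ge0.
have [v0 vA] := near_pole p u ur pz.
have [v0' vA'] := near_pole p (u + h) uhr pz.
rewrite !wp_termE.
set v := u - L p in v0 vA *.
have vhE : u + h - L p = v + h by rewrite /v; ring.
rewrite vhE in v0' vA' *.
set c := (if _ then _ else _).
have -> : 1 / (v + h) ^+ 2 - c - (1 / v ^+ 2 - c) - h * (- 2 / v ^+ 3) =
    h ^+ 2 * (v^-1 ^+ 2 * (v + h)^-1 ^+ 2 + (v^-1 ^+ 3 * (v + h)^-1 + v^-1 ^+ 3 * (v + h)^-1)).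
  by field; rewrite v0 v0'.
rewrite cmodM cmodX ler_wpM2l //.
apply: (concl p _ (3 * A ^+ 4)); [lra|by rewrite /K; lra|].
have Aq : 0 <= A * q p by rewrite mulr_ge0 // ltW.
have a0 : 0 <= (cmod v)^-1 by rewrite invr_ge0 cmod_ge0.
have b0 : 0 <= (cmod (v + h))^-1 by rewrite invr_ge0 cmod_ge0.
have e1 : (cmod v)^-1 ^+ 2 * (cmod (v + h))^-1 ^+ 2 <= (A * q p) ^+ 2 * (A * q p) ^+ 2.
  by apply: ler_pM; rewrite ?exprn_ge0 // lerXn2r ?nnegrE.
have e2 : (cmod v)^-1 ^+ 3 * (cmod (v + h))^-1 <= (A * q p) ^+ 3 * (A * q p).
  by apply: ler_pM; rewrite ?exprn_ge0 // lerXn2r ?nnegrE.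
have e3 : 3 * A ^+ 4 * q p ^+ 4 <= 3 * A ^+ 4 * q p ^+ 3.
  apply: ler_wpM2l; first lra.
  by rewrite [q p ^+ 4]exprS ler_piMl ?exprn_ge0.
apply: le_trans e3; apply: le_trans (cmodD _ _) _.
have := cmodD (v^-1 ^+ 3 * (v + h)^-1) (v^-1 ^+ 3 * (v + h)^-1).
rewrite (cmodM (v^-1 ^+ 2)) (cmodM (v^-1 ^+ 3)) !cmodX !cmodV.
move: e1 e2; rewrite (_ : (A * q p) ^+ 2 * (A * q p) ^+ 2 = A ^+ 4 * q p ^+ 4); last by ring.
rewrite (_ : (A * q p) ^+ 3 * (A * q p) = A ^+ 4 * q p ^+ 4); last by ring.
lra.
Qed.

End WeierstrassP.

(** * Discs as neighbourhoods, and the numerator at a double pole *)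

Section Neighbourhoods.
Variable R : realType.
Implicit Types z u : R[i].

Lemma near_cmod (P : R[i] -> Prop) z (r : R) : 0 < r ->
  (forall u, cmod (u - z) < r -> P u) -> \forall u \near (z : R[i]^o), P u.
Proof.
move=> r0 H; apply/nbhs_ballP; exists r%:C => /=; first by rewrite ltcR.
move=> u; rewrite -ball_normE /= cmodE ltcR cmodC; exact: H.
Qed.

Lemma dnear_cmod (P : R[i] -> Prop) z (r : R) : 0 < r ->
  (forall u, u != z -> cmod (u - z) < r -> P u) ->
  \forall u \near (z : R[i]^o)^', P u.
Proof.
move=> r0 H; have : \forall u \near (z : R[i]^o), u != z -> P u.
  by apply: near_cmod r0 _ => u ur uz; apply: H.
by apply: filterS => u Hu uz; apply: Hu.
Qed.

(** The numerator over (v - z)^2 of f v - c plus a double pole at z. *)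
Lemma cderivable_pole (f : R[i] -> R[i]) (c z u : R[i]) :
  cderivable f u -> cderivable (fun v => (f v - c) * (v - z) ^+ 2 + 1) u.
Proof.
move=> fu; rewrite /cderivable.
apply: (@derivableD R[i] R[i]^o R[i]^o); last exact: derivable_cst.
apply: (@derivableM R[i] R[i]^o).
  by apply: (@derivableB R[i] R[i]^o R[i]^o); [exact: fu|exact: derivable_cst].
have -> : (fun v : R[i]^o => (v - z) ^+ 2 : R[i]) = (fun v => v - z) * (fun v => v - z).
  by apply/funext => v; rewrite expr2.
by apply: (@derivableM R[i] R[i]^o); apply: (@derivableB R[i] R[i]^o R[i]^o);
  [exact: derivable_id|exact: derivable_cst|exact: derivable_id|exact: derivable_cst].
Qed.

End Neighbourhoods.

(** * Meromorphy and the expansion in q *)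

Section Identity.
Variable R : realType.
Variable tau : R[i].
Hypothesis tau_gt0 : 0 < complex.Im tau.
Implicit Types z u : R[i].
Local Notation L := (lattice_point tau).

Lemma wp_term_away_sums z : exists2 r : R, 0 < r &
  (forall u, cmod (u - z) < r -> cderivable (fun v => csum (fun p => wp_term_away tau z p v)) u)
  /\ (forall u, cmod (u - z) < r ->
    sums_to (fun p => wp_term_away tau z p u) (csum (fun p => wp_term_away tau z p u))).
Proof.
have [K [r [K0 r0 bA bD bR]]] := wp_term_bounds tau_gt0 z.
exists (r / 2); first by rewrite divr_gt0.
split=> u ur.
  have shift h : cmod h <= r / 2 -> cmod (u + h - z) <= r.
    by move=> hr; rewrite addrAC; have := cmodD (u - z) h; lra.
  have ur' : cmod (u - z) <= r by lra.
  apply: (@csum_cderivable _ _ _ (fun p => wp_term_deriv tau z p u) u K (14 * 14) (r / 2) (pwt3 R)) => //.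
  - by rewrite divr_gt0.
  - exact: pwt3_ge0.
  - exact: abs_bounded_pwt3.
  - by move=> p h hr; apply: bA; exact: shift.
  - by move=> p; apply: bD.
  - by move=> p h hr; apply: bR => //; exact: shift.
have [|s us] := @abs_bounded_sums_to _ _ (fun p => wp_term_away tau z p u) (K * (14 * 14)).
  apply: abs_bounded_le (@abs_bounded_pwt3 R) => // p.
  by rewrite cmod_real (ger0_norm (pwt3_ge0 _ _)); apply: bA; lra.
by rewrite (sums_to_csum us).
Qed.

(** At a lattice point the pole is double and the rest of the series is
    holomorphic. Away from the lattice the whole series is holomorphic. *)
Lemma meromorphic_wp : meromorphic (fun u => wp u tau).
Proof.
move=> z; have [r r0 [dS sS]] := wp_term_away_sums z.
set S := (fun v => csum _) in dS.
have [[p0 _ Lp0]|zL] := pselect (lattice tau z).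
  pose c : R[i] := if p0 == (0, 0) then 0 else 1 / z ^+ 2.
  exists 2%N, (fun u => (S u - c) * (u - z) ^+ 2 + 1); split.
    by apply: (near_cmod r0) => u ur; apply: cderivable_pole; apply: dS.
  apply: (dnear_cmod r0) => u uz ur; have uz0 : u - z != 0 by rewrite subr_eq0.
  have -> : ((S u - c) * (u - z) ^+ 2 + 1) / (u - z) ^+ 2 = S u + (1 / (u - z) ^+ 2 - c).
    by field.
  apply: sums_to_wp.
  apply: eq_sums_to (sums_toD (sS u ur) (sums_to_single p0 (1 / (u - z) ^+ 2 - c))) => p.
  rewrite /wp_term_away; have [->|pp0] := eqVneq p p0.
    by rewrite Lp0 eqxx add0r wp_termE Lp0.
  rewrite -Lp0 (inj_eq (lattice_point_inj tau_gt0)) (negbTE pp0) addr0 //.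
exists 0%N, S; split.
  by apply: (near_cmod r0) => u ur; apply: dS.
apply: (dnear_cmod r0) => u uz ur; rewrite expr0 divr1.
apply: sums_to_wp; apply: eq_sums_to (sS u ur) => p.
rewrite /wp_term_away; case: eqP => // pz; case: zL; by exists p.
Qed.

Lemma lattice_discrete z : exists2 r : R, 0 < r &
  forall u, u != z -> cmod (u - z) < r -> ~ lattice tau u.
Proof.
have [d d0 Hd] := lattice_dist tau_gt0 z; exists d => // u uz ur [p _ pu].
move: uz; rewrite -pu => /Hd; rewrite pu cmodC => h.
by have := cmod_ge0 u; nra.
Qed.

(** Meromorphy only concerns punctured neighbourhoods, and small ones avoid the
    lattice. *)
Lemma meromorphic_off_lattice (f : R[i] -> R[i]) :
  (forall u, ~ lattice tau u -> wp u tau = f u) -> meromorphic f.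
Proof.
move=> H z; have [k [g [dg fg]]] := meromorphic_wp z; exists k, g; split => //.
have [r r0 Hr] := lattice_discrete z.
have : \forall u \near (z : R[i]^o)^', ~ lattice tau u by exact: dnear_cmod Hr.
by move: fg; apply: filterS2 => u + /H => ->.
Qed.

Lemma inv_sqr_le_wt3 (n : int) (x : R) : 0 < x -> wt R n ^+ 2 <= x -> (x ^+ 2)^-1 <= wt3 R n.
Proof.
move=> x0 nx; have w1 := wt_ge1 R n; have w0 := wt_gt0 R n.
rewrite lef_pV2 ?posrE ?exprn_gt0 //.
apply: (@le_trans _ _ ((wt R n ^+ 2) ^+ 2)).
  by rewrite -exprM ler_weXn2l.
by rewrite lerXn2r ?nnegrE ?exprn_ge0 // ltW.
Qed.

Lemma wt_sqr_neq0 (n : int) : n != 0 -> wt R n ^+ 2 = `|n|%:~R.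
Proof.
move=> n0; rewrite wt_sqr -natr_absz; congr (_%:R); apply/maxn_idPr.
by rewrite absz_gt0.
Qed.

(** The weights bound the row because |z + n| is at least a multiple of 1 + |n|. *)
Lemma sums_to_row z : nonint z ->
  sums_to (fun n : int => 1 / (z + n%:~R) ^+ 2) (cscsq z).
Proof.
move=> zZ.
have [||d d0 Hd] := @separated_dist R int (fun n => (- n)%:~R) 1 z _ _ => //.
  move=> p q pq; rewrite -intrB cmod_int ler1z -gtz0_ge1 normr_gt0.
  by rewrite opprK addrC subr_eq0 eq_sym.
apply: (@sums_to_cscsq _ _ ((d ^+ 2)^-1 * 14)) => //.
apply: abs_bounded_le (@abs_bounded_wt3 R) => [|n].
  by rewrite invr_ge0 exprn_ge0 // ltW.
rewrite cmod_real (ger0_norm (wt3_ge0 _ _)) div1r cmodV cmodX.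
have : (- n)%:~R != z by apply/eqP => /esym /zZ.
move=> /Hd; rewrite mulrNz opprK cmodN cmod_int => h.
have n0 : 0 <= `|n|%:~R :> R by rewrite ler0z.
apply: (@le_trans _ _ ((d * (1 + `|n|%:~R)) ^+ 2)^-1).
  have q0 : 0 < d * (1 + `|n|%:~R) by rewrite mulr_gt0 //; lra.
  rewrite lef_pV2 ?posrE ?exprn_gt0 // ?(lt_le_trans q0) //.
  by rewrite lerXn2r ?nnegrE ?cmod_ge0 // ltW.
rewrite exprMn invfM ler_wpM2l ?invr_ge0 ?exprn_ge0 ?(ltW d0) //.
apply: inv_sqr_le_wt3; first lra.
have [->|/wt_sqr_neq0 ->] := eqVneq n 0; last lra.
by rewrite /wt /= sqrtr1 expr1n addr0.
Qed.

Definition eis_term (p : int * int) : R[i] :=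
  if p == (0, 0) then 0 else 1 / L p ^+ 2.

Lemma nonint_mul_tau (m : int) : m != 0 -> nonint (m%:~R * tau).
Proof.
move=> m0 n; rewrite -!(rmorph_int (real_complex R)) => /(congr1 (@complex.Im R)) /=.
rewrite Im_realM => /eqP; rewrite mulf_eq0 intr_eq0 (negbTE m0) /=.
by rewrite gt_eqF.
Qed.

(** For m <> 0 the m-th row sums to [cscsq (m tau)], of size at most
    1 / (m Im tau)^2. For m = 0 only the existence of the sum matters: its value
    occurs in the Weierstrass series and in E2, and cancels. *)
Lemma eisenstein_rows : exists e : int -> R[i], exists eS : R[i],
  (forall m, sums_to (fun n => eis_term (m, n)) (e m)) /\ sums_to e eS.
Proof.
have [|e0 He0] := @abs_bounded_sums_to R int (fun n => eis_term (0, n)) (1 * 14).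
  apply: abs_bounded_le (@abs_bounded_wt3 R) => // n.
  rewrite cmod_real (ger0_norm (wt3_ge0 _ _)) mul1r /eis_term.
  have [->|n0] := eqVneq n 0; first by rewrite eqxx cmod0 wt3_ge0.
  rewrite xpair_eqE eqxx (negbTE n0) /lattice_point /= mul0r add0r div1r cmodV cmodX cmod_int.
  by apply: inv_sqr_le_wt3; rewrite ?wt_sqr_neq0 // ltr0z normr_gt0.
pose e m := if m == 0 then e0 else cscsq (m%:~R * tau).
pose C : R := cmod e0 + (complex.Im tau ^+ 2)^-1.
have t2 : 0 <= (complex.Im tau ^+ 2)^-1 by rewrite invr_ge0 sqr_ge0.
have [|eS HeS] := @abs_bounded_sums_to R int e (C * 14).
  apply: abs_bounded_le (@abs_bounded_wt3 R) => [|m].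
    by rewrite addr_ge0 ?cmod_ge0.
  rewrite cmod_real (ger0_norm (wt3_ge0 _ _)) /e /C mulrDl.
  have [->|m0] := eqVneq m 0.
    have -> : wt3 R 0 = 1 by rewrite /wt3 /wt /= sqrtr1 expr1n invr1.
    by rewrite !mulr1 lerDl.
  have im : complex.Im (m%:~R * tau) = m%:~R * complex.Im tau.
    by rewrite -(rmorph_int (real_complex R)) Im_realM.
  apply: le_trans (cscsq_le_Im _) _.
    by rewrite im mulf_neq0 ?intr_eq0 // gt_eqF.
  rewrite im exprMn invfM mulrC ler_wpDl ?mulr_ge0 ?cmod_ge0 ?wt3_ge0 //.
  rewrite ler_wpM2l // -(real_normK (num_real m%:~R)) -intr_norm.
  by apply: inv_sqr_le_wt3; rewrite ?wt_sqr_neq0 // ltr0z normr_gt0.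
exists e, eS; split=> // m; rewrite /e; have [->//|m0] := eqVneq m 0.
apply: eq_sums_to (sums_to_row (nonint_mul_tau m0)) => n.
by rewrite /eis_term xpair_eqE (negbTE m0).
Qed.

(** Summing the series of the Weierstrass function along rows gives
    [cscsq (u - m tau)] minus the m-th Eisenstein row. Since the Eisenstein rows
    are summable by themselves, the two parts may be separated. *)
Lemma wp_q_expansion u : ~ lattice tau u ->
  wp u tau = (2 * (pi : R)%:C * 'i%C) ^+ 2 * calW (qexp u) (qexp tau)
    - (pi : R)%:C ^+ 2 / 3 * E2 tau.
Proof.
move=> uL.
have [r r0 [_ /(_ u)]] := wp_term_away_sums u; rewrite subrr cmod0 => /(_ r0).
set s := csum _ => Hs.
have {}Hs : sums_to (fun p => wp_term tau p u) s.
  apply: eq_sums_to Hs => p; rewrite /wp_term_away; case: eqP => // pu.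
  by case: uL; exists p.
rewrite (sums_to_wp Hs).
have [e [eS [He HeS]]] := eisenstein_rows.
have uZ (m : int) : nonint (u - m%:~R * tau).
  move=> n un; case: uL; exists (m, n) => //.
  by rewrite /lattice_point /= -un addrC subrK.
have rows m : sums_to (fun n => wp_term tau (m, n) u) (cscsq (u - m%:~R * tau) - e m).
  have Nbij : bijective (-%R : int -> int) by exists -%R; exact: opprK.
  apply: eq_sums_to (sums_toB (sums_to_reindex Nbij (sums_to_row (uZ m))) (He m)) => n.
  rewrite wp_termE /eis_term mulrNz; congr (1 / _ ^+ 2 - _).
  by rewrite /lattice_point /= opprD addrA.
have Hm : sums_to (fun m : int => cscsq (u - m%:~R * tau)) (s + eS).
  apply: eq_sums_to (sums_toD (sums_to_iter Hs rows) HeS) => m.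
  by rewrite subrK.
have p0 : (pi : R)%:C != 0.
  by rewrite -(rmorph0 (real_complex R)) (inj_eq (@complexI R)) gt_eqF ?pi_gt0.
have c0 : (2 * (pi : R)%:C * 'i%C) ^+ 2 != 0.
  by rewrite expf_neq0 // !mulf_neq0 ?i_neq0 // pnatr_eq0.
have -> : calW (qexp u) (qexp tau) = ((2 * (pi : R)%:C * 'i%C) ^+ 2)^-1 * (s + eS).
  apply: sums_to_csum; have Nbij : bijective (-%R : int -> int) by exists -%R; exact: opprK.
  apply: eq_sums_to (sums_toZ _ (sums_to_reindex Nbij Hm)) => m.
  by rewrite mulrNz mulNr opprK /cscsq mulKf // qexpD qexp_int.
have -> : E2 tau = 3 / (pi : R)%:C ^+ 2 * eS.
  rewrite /E2; congr (_ * _); apply: sums_to_csum; apply: eq_sums_to HeS => m.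
  apply/esym/sums_to_csum; exact: (He m).
rewrite mulVKf //; move: p0; move: ((pi : R)%:C) => P P0.
by field; rewrite P0.
Qed.

End Identity.

Unset Implicit Arguments.
Set Strict Implicit.
Set Printing Implicit Defensive.

Theorem mainTheorem2 (R : realType) (tau : R[i]) (htau : 0 < complex.Im tau) :
  let q := cexp (2 * (pi : R)%:C * 'i%C * tau) in
  let rhs := fun u : R[i] =>
    let w := cexp (2 * (pi : R)%:C * 'i%C * u) in
    (2 * (pi : R)%:C * 'i%C) ^+ 2 * calW w q - (pi : R)%:C ^+ 2 / 3 * E2 tau in
  [/\ meromorphic (fun u => wp u tau),
      meromorphic rhs &
      forall u : R[i], ~ lattice tau u -> wp u tau = rhs u].
Proof.
have H := wp_q_expansion htau; split => //.
- exact: meromorphic_wp.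
- exact: meromorphic_off_lattice H.
Qed.
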